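(* Let $\Gamma$ be a compact Lie group acting linearly on a finite-dimensional real vector space $V$ equipped with a $\Gamma$-invariant inner product, and let $\sigma:\Gamma\to\mathbf{Z}_2=\{\pm1\}$ be a group homomorphism. Let $k\ge 1$ and let $h\in J^k(\Gamma_\sigma)$ be a $\Gamma$-reversible-equivariant $k$-jet, regarded as a $\Gamma$-reversible-equivariant polynomial map germ $V,0\to V$ of degree at most $k$ with $h(0)=0$. Let $L=(dh)_0$, let $L^t$ be the adjoint of $L$, and let $\mathbf{S}=\overline{\{e^{sL^t} : s\in\mathbb{R}\}}$. Then $$ \vec{\mathcal{F}}_{V,k+1}(\Gamma)\subset \vec{\mathcal{Q}}_V^{k+1}(\mathbf{S}\rtimes\Gamma) + T\tilde{\mathcal{G}}\cdot h + \vec{\mathcal{F}}_{V,k+2}(\Gamma). $$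
   Context: $\mathcal{E}_V$ is the ring of $C^\infty$ function germs $V,0\to\mathbb{R}$. Its maximal ideal is $\mathcal{M}=\{f\in\mathcal{E}_V : f(0)=0\}$, and $\mathcal{M}^j$ denotes its $j$-th power. $\vec{\mathcal{E}}_V$ is the $\mathcal{E}_V$-module of $C^\infty$ map germs defined at $0\in V$ with values in $V$. Thus $\mathcal{M}^{j}\vec{\mathcal{E}}_V$ consists of the germs whose Taylor expansion at $0$ has no terms of degree less than $j$. $\vec{\mathcal{P}}_V^{l}$ is the space of homogeneous polynomial maps $V\to V$ of degree $l$. A map germ $g\in\vec{\mathcal{E}}_V$ is $\Gamma$-equivariant if $g(\gamma x)=\gamma g(x)$ for all $\gamma\in\Gamma$. It is $\Gamma$-reversible-equivariant if $g(\gamma x)=\sigma(\gamma)\gamma g(x)$ for all $\gamma\in\Gamma$. $\vec{\mathcal{P}}_V^{l}(\Gamma)$ is the space of $\Gamma$-equivariant elements of $\vec{\mathcal{P}}_V^l$. $\vec{\mathcal{F}}_V(\Gamma)$ is the space of $\Gamma$-reversible-equivariant germs in $\vec{\mathcal{E}}_V$, and $\vec{\mathcal{F}}_{V,j}(\Gamma)=\mathcal{M}^{j}\vec{\mathcal{E}}_V\cap\vec{\mathcal{F}}_V(\Gamma)$. $J^k(\Gamma_\sigma)$ is the space of $k$-jets at $0$ of germs $g\in\vec{\mathcal{F}}_V(\Gamma)$ with $g(0)=0$. Each jet is identified with its Taylor polynomial of degree at most $k$. The closure in $\mathbf{S}=\overline{\{e^{sL^t} : s\in\mathbb{R}\}}$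 is taken in $\mathrm{GL}(V)$, and $\mathbf{S}$ acts linearly on $V$. The semidirect product $\mathbf{S}\rtimes\Gamma$ is induced by the homomorphism $\mu:\Gamma\to\mathrm{Aut}(\mathbf{S})$, $\mu(\gamma)(e^{sL^t})=e^{\sigma(\gamma)sL^t}$. It acts on $V$ by $(A,\gamma)x=A\gamma x$. The homomorphism $\sigma$ is extended to $\mathbf{S}\rtimes\Gamma$ by $(A,\gamma)\mapsto\sigma(\gamma)$, so that elements of $\mathbf{S}$ are symmetries. Accordingly, $\vec{\mathcal{Q}}_V^{l}(\mathbf{S}\rtimes\Gamma)$ is the space of all $p\in\vec{\mathcal{P}}_V^l$ such that $p(A\gamma x)=\sigma(\gamma)A\gamma\,p(x)$ for all $A\in\mathbf{S}$, $\gamma\in\Gamma$, $x\in V$. $\tilde{\mathcal{G}}$ consists of the changes of coordinates $\xi:V,0\to V$ of the form $\xi=I+\tilde\xi$, where $I$ is the identity germ and $\tilde\xi\in\bigoplus_{l\ge2}\vec{\mathcal{P}}_V^l(\Gamma)$. It acts on germs $h\in\vec{\mathcal{F}}_V(\Gamma)$ with $h(0)=0$ by $(\xi\cdot h)(x)=\big((d\xi)_x\big)^{-1}h(\xi(x))$. The tangent space $T\tilde{\mathcal{G}}\cdot h$ to the orbit of $h$ is the set of all germs $x\mapsto \frac{d}{dt}\phi(x,t)\big|_{t=0}$, where $\phi(x,t)=\big((d\xi(\cdot,t))_x\big)^{-1}h(\xi(x,t))$ and $\xi(\cdot,t)$ ranges over the smooth one-parameter families in $\tilde{\mathcal{G}}$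 with $\xi(x,0)=x$. Sums of subsets of $\vec{\mathcal{E}}_V$ are elementwise sums. *)

(* Defs.v *)
From HB Require Import structures.
From mathcomp Require Import all_boot all_order all_algebra.
From mathcomp Require Import all_classical all_reals all_analysis.
Import Order.TTheory GRing.Theory Num.Theory.
Import numFieldNormedType.Exports.

Set Implicit Arguments.
Unset Strict Implicit.
Unset Printing Implicit Defensive.

Local Open Scope classical_set_scope.
Local Open Scope ring_scope.

#[short(type="finNormedModType")]
HB.structure Definition FinNormedModule (R : numFieldType) :=
  {V of NormedModule R V & Vector R V}.

(* Functions are total, and a germ at a point is represented by any function
   having that germ: conditions on germs are imposed only near the point. *)

Definition iter_derive (R : realType) (V W : normedModType R)
    (f : V -> W) (vs : seq V) : V -> W :=
  foldr (fun v g => 'D_v g) f vs.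

(* C^oo near x: all iterated directional derivatives exist and are continuous
   on one neighbourhood of x. On finite-dimensional spaces (the only ones to
   which it is applied) this is the usual notion. *)
Definition smooth_at (R : realType) (V W : normedModType R)
    (f : V -> W) (x : V) : Prop :=
  \forall y \near x, forall vs : seq V,
    {for y, continuous (iter_derive f vs)} /\
    forall v, derivable (iter_derive f vs) y v.

Definition smooth_on (R : realType) (V W : normedModType R)
    (U : set V) (f : V -> W) : Prop :=
  forall x, U x -> smooth_at f x.

HB.mixin Record isTopologicalGroup G of Group G & Topological G := {
  mulg_continuous : continuous (fun u : G * G => (u.1 * u.2)%g);
  invg_continuous : continuous (fun g : G => (g^-1)%g)
}.

#[short(type="topGroupType")]
HB.structure Definition TopologicalGroup :=
  {G of Group G & Topological G & isTopologicalGroup G}.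

Section LieGroup.
Context (R : realType) (G : topGroupType) (d : nat).

(* Only the restrictions of [coord] to [dom] and of [param] to
   [coord @` dom] are meaningful. *)
Record chart := Chart {
  dom : set G;
  coord : G -> 'rV[R]_d;
  param : 'rV[R]_d -> G }.

Definition is_chart (c : chart) : Prop :=
  [/\ open (dom c), open (coord c @` dom c),
      forall g, dom c g -> param c (coord c g) = g,
      {within dom c, continuous (coord c)} &
      {within coord c @` dom c, continuous (param c)}].

Definition is_smooth_atlas (A : set chart) : Prop :=
  [/\ forall c, A c -> is_chart c,
      forall g, exists2 c, A c & dom c g &
      forall c c', A c -> A c' ->
        smooth_on (coord c @` (dom c `&` dom c')) (coord c' \o param c)].

(* The sets on which smoothness is required are open, by continuity of the
   group operations. *)
Definition smooth_operations (A : set chart) : Prop :=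
  (forall c1 c2 c3, A c1 -> A c2 -> A c3 ->
    smooth_on [set u : 'rV[R]_d * 'rV[R]_d |
                 [/\ (coord c1 @` dom c1) u.1, (coord c2 @` dom c2) u.2 &
                     dom c3 (param c1 u.1 * param c2 u.2)%g]]
      (fun u => coord c3 (param c1 u.1 * param c2 u.2)%g)) /\
  (forall c1 c2, A c1 -> A c2 ->
    smooth_on [set u : 'rV[R]_d |
                 (coord c1 @` dom c1) u /\ dom c2 ((param c1 u)^-1)%g]
      (fun u => coord c2 ((param c1 u)^-1)%g)).

End LieGroup.

Definition lie_group (R : realType) (G : topGroupType) : Prop :=
  [/\ hausdorff_space G, @second_countable G &
      exists (d : nat) (A : set (chart R G d)),
        is_smooth_atlas A /\ smooth_operations A].

Section Germs.
Context (R : realType) (V : finNormedModType R).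

Definition maximal_ideal : set (V -> R) :=
  [set a | smooth_at a 0 /\ a 0 = 0].

(* M^j E_V(V): the finite sums of germs a_1 ... a_j g, with a_1, ..., a_j in
   the maximal ideal M and g a smooth map germ. *)
Definition MjE (j : nat) : set (V -> V) :=
  [set f | exists (m : nat) (a : 'I_m -> 'I_j -> V -> R) (g : 'I_m -> V -> V),
    [/\ forall i l, maximal_ideal (a i l),
        forall i, smooth_at (g i) 0 &
        \forall x \near 0, f x = \sum_i (\prod_l a i l x) *: g i x]].

(* P^l = Sym^l(V^* ) (x) V: the span of the maps x |-> c_1(x) ... c_l(x) v, with
   c_1, ..., c_l linear forms and v in V. *)
Definition homog_poly (l : nat) : set (V -> V) :=
  [set p | exists (m : nat) (c : 'I_m -> 'I_l -> {scalar V}) (v : 'I_m -> V),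
    forall x, p x = \sum_i (\prod_j c i j x) *: v i].

Definition poly_upto (k : nat) : set (V -> V) :=
  [set h | exists p : nat -> V -> V, (forall l, homog_poly l (p l)) /\
    forall x, h x = \sum_(0 <= l < k.+1) p l x].

Definition germ_add (A B : set (V -> V)) : set (V -> V) :=
  [set f | exists a b, [/\ A a, B b & \forall x \near 0, f x = a x + b x]].

Definition adjoint (dot : {dot V for idfun}) (L Lt : V -> V) : Prop :=
  forall x y, dot (L x) y = dot x (Lt y).

Definition exp_lin (s : R) (B : V -> V) (x : V) : V :=
  limn (series (fun n => (s ^+ n / n`!%:R) *: iter n B x)).

(* Closure of {e^{sB} : s in R} in GL(V), whose topology is that of the
   operator norm. *)
Definition exp_closure (B : V -> V) : set 'End(V) :=
  [set A | lker A == 0%VS /\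
    forall e : R, 0 < e ->
      exists s : R, forall x, `|A x - exp_lin s B x| <= e * `|x|].

End Germs.

Section Action.
Context (R : realType) (V : finNormedModType R) (G : topGroupType).

Definition linear_action (rho : G -> 'End(V)) : Prop :=
  [/\ rho 1%g = \1%VF,
      forall g1 g2, rho (g1 * g2)%g = (rho g1 \o rho g2)%VF &
      continuous (fun z : G * V => rho z.1 z.2)].

Definition sign_hom (sigma : G -> R) : Prop :=
  (forall g, sigma g = 1 \/ sigma g = -1) /\
  (forall g1 g2, sigma (g1 * g2)%g = sigma g1 * sigma g2).

Context (rho : G -> 'End(V)) (sigma : G -> R).

Definition equivariant_poly (l : nat) : set (V -> V) :=
  [set p | homog_poly l p /\ forall g x, p (rho g x) = rho g (p x)].

(* Equality of germs for each g: the neighbourhood may depend on g. *)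
Definition rev_equivariant : set (V -> V) :=
  [set f | smooth_at f 0 /\
    forall g, \forall x \near 0, f (rho g x) = sigma g *: rho g (f x)].

Definition rev_equivariant_order (j : nat) : set (V -> V) :=
  @MjE R V j `&` rev_equivariant.

Definition rev_equivariant_jet (k : nat) : set (V -> V) :=
  [set h | poly_upto k h /\
    exists g, [/\ rev_equivariant g, g 0 = 0 &
                  MjE k.+1 (fun x => g x - h x)]].

(* The elements of S are symmetries and (A, g) acts as x |-> A (g x). *)
Definition rev_equivariant_poly_semidirect (S : set 'End(V)) (l : nat) :
    set (V -> V) :=
  [set p | homog_poly l p /\
    forall A g x, S A -> p (A (rho g x)) = sigma g *: A (rho g (p x))].

Definition coord_changes : set (V -> V) :=
  [set xi | exists (N : nat) (p : nat -> V -> V),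
    (forall l, (2 <= l)%N -> equivariant_poly l (p l)) /\
    forall x, xi x = x + \sum_(2 <= l < N) p l x].

Definition change_action (xi h : V -> V) (x : V) : V :=
  ((linfun ('d xi x))^-1)%VF (h (xi x)).

Definition coord_change_family (xi : V -> R -> V) : Prop :=
  [/\ smooth_at (fun z : V * R => xi z.1 z.2) (0, 0),
      \forall t \near (0 : R), coord_changes (xi ^~ t) &
      forall x, xi x 0 = x].

Definition tangent_space (h : V -> V) : set (V -> V) :=
  [set f | exists xi, coord_change_family xi /\
    \forall x \near 0,
      f x = derive1 (fun t => change_action (xi ^~ t) h x) 0].

End Action.

(* Main.v *)
(* For a homogeneous polynomial map p put ad_L p (x) = L (p x) - dp_x (L x). On the
   homogeneous maps of degree k+1 there is an inner product for which Gamma acts by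
   isometries and ad_{L^t} is the adjoint of ad_L. Hence the leading term q of a germ
   in F_{k+1} is ad_L (ad_{L^t} z) + q' with ad_{L^t} q' = 0. Since ad_{L^t} z lies in
   the orthogonal complement of ker ad_L, it is determined by q and therefore
   equivariant; no averaging over Gamma is needed. The equation ad_{L^t} q' = 0 means
   that q' commutes with the flow e^{sL^t}, hence with S. Finally the family
   x + t p(x), with p = ad_{L^t} z, gives the tangent vector
   dh_x (p x) - dp_x (h x) = ad_L p + O(|x|^{k+2}).
   That remainders lie in M^{k+2} E, which is defined by sums of products, rests on
   Hadamard's lemma. *)

Require Import Defs.
From HB Require Import structures.
From mathcomp Require Import all_boot all_order all_algebra.
From mathcomp Require Import all_classical all_reals all_analysis.
From mathcomp Require Import ring lra.
Import Order.TTheory GRing.Theory Num.Theory.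
Import numFieldNormedType.Exports.

Local Open Scope classical_set_scope.
Local Open Scope ring_scope.

Set Implicit Arguments.
Unset Strict Implicit.
Unset Printing Implicit Defensive.

(** The adjoint argument needs a finite-dimensional space, whereas homogeneous maps form a set of
    functions. They are lifted to the space of all tensors with l slots, symmetric or not, in
    coordinates of an orthonormal basis of V. There the plain coordinatewise product serves, without
    multinomial weights: the derivation lifting ad_B has the one lifting ad_{B^t} as adjoint, and
    isometries act compatibly. Evaluation on the diagonal intertwines the operators, so a
    decomposition found among tensors descends to polynomial maps. The signs explain why the two
    summands have different types. Since L and L^t commute with gamma up to sigma(gamma), so do
    their lifts; the sign carried by q cancels against that of ad_L, which leaves p equivariant,
    while q' stays reversible-equivariant. A jet h is given only as the Taylor polynomial of a
    symmetric germ; its own symmetry is recovered by comparing limits along lines through 0. *)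

(** * Euclidean linear algebra: adjoint operators and orthonormal bases *)

Section InnerProduct.
Context (R : realType) (W : vectType R) (b : W -> W -> R).
Hypotheses (b_sym : forall x y, b x y = b y x)
  (bD : forall x y z, b (x + y) z = b x z + b y z)
  (bZ : forall a x z, b (a *: x) z = a * b x z)
  (b_gt0 : forall x, x != 0 -> 0 < b x x).

Let b0 y : b 0 y = 0. Proof. by rewrite -(scale0r (0 : W)) bZ mul0r. Qed.

Let b_eq0 x : b x x = 0 -> x = 0.
Proof. by move=> bx; apply/eqP; apply: contraT => /b_gt0; rewrite bx ltxx. Qed.

(** The operator [S], the product of [A] and [At], is symmetric, so its image and kernel meet
    trivially and fill the space by dimension. Its kernel is that of [At], because b (At x) (At x) =
    b (S x) x. *)
Lemma adjoint_decomposition (A At : 'End(W)) :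
  (forall x y, b (A x) y = b x (At y)) ->
  forall q, exists z, At (q - A (At z)) = 0.
Proof.
move=> adjA q.
pose S := (A \o At)%VF; have SE x : S x = A (At x) by rewrite comp_lfunE.
have SAt x : S x = 0 -> At x = 0.
  by rewrite SE => Sx; apply: b_eq0; rewrite -adjA Sx b0.
have Ssym x y : b (S x) y = b x (S y).
  by rewrite !SE adjA b_sym [RHS]b_sym adjA.
have full : (limg S + lker S)%VS = fullv.
  have cap0 : (limg S :&: lker S)%VS = 0%VS.
    apply/eqP; rewrite -subv0; apply/subvP => x; rewrite memv_cap memv0.
    case/andP => /memv_imgP[y _ ->]; rewrite memv_ker => /eqP SSy.
    by apply/eqP/b_eq0; rewrite Ssym SSy b_sym b0.
  apply/eqP; rewrite eqEdim subvf dimv_disjoint_sum// addnC.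
  have := limg_ker_dim S fullv; rewrite capfv => ->; exact: leqnn.
have : q \in (limg S + lker S)%VS by rewrite full memvf.
case/memv_addP => _ /memv_imgP[z _ ->] [r]; rewrite memv_ker => /eqP Sr ->.
by exists z; apply: SAt; rewrite -SE addrAC subrr add0r.
Qed.

(** Gram-Schmidt: as long as m is below the dimension, some vector lies outside the span, and its
    component orthogonal to the family can be normalized and adjoined. An orthonormal family of full
    cardinality is free, hence a basis. *)
Lemma orthonormal_basis : exists e : 'I_(\dim {:W}) -> W,
  (forall i j, b (e i) (e j) = (i == j)%:R) /\
  (forall x, x = \sum_i b x (e i) *: e i).
Proof.
have bN x y : b (- x) y = - b x y by rewrite -scaleN1r bZ mulN1r.
have bs n (F : 'I_n -> W) y : b (\sum_i F i) y = \sum_i b (F i) y.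
  by elim/big_ind2: _ => // [x1 x2 y1 y2 <- <-].
have proj n (e : 'I_n -> W) : (forall i j, b (e i) (e j) = (i == j)%:R) ->
    forall w i, b (w - \sum_i b w (e i) *: e i) (e i) = 0.
  move=> oe w i; rewrite bD bN bs (bigD1 i)//= big1 => [|j ji].
    by rewrite bZ oe eqxx mulr1 addr0 subrr.
  by rewrite bZ oe (negbTE ji) mulr0.
have [e oe] : exists e : 'I_(\dim {:W}) -> W,
    forall i j, b (e i) (e j) = (i == j)%:R.
  suff: forall m, (m <= \dim {:W})%N -> exists e : 'I_m -> W,
      forall i j, b (e i) (e j) = (i == j)%:R by apply.
  elim=> [_|m IHm ltm].
    by exists (fun=> 0) => -[].
  have [e oe] := IHm (ltnW ltm).
  have : ~ (fullv <= <<[seq e i | i : 'I_m]>>)%VS.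
    move/dimvS => /leq_trans/(_ (dim_span _)).
    by rewrite size_map size_enum_ord leqNgt ltm.
  move/negP/subvPn => [w _ wN]; pose v := w - \sum_i b w (e i) *: e i.
  have v_neq0 : v != 0.
    apply: contra wN; rewrite subr_eq0 => /eqP ->.
    by apply: memv_suml => i _; rewrite memvZ// memv_span// map_f// mem_enum.
  pose u := (Num.sqrt (b v v))^-1 *: v.
  have ou i : b u (e i) = 0 by rewrite bZ proj// mulr0.
  have uu : b u u = 1.
    rewrite bZ b_sym bZ mulrA -expr2 exprVn sqr_sqrtr ?ltW ?b_gt0//.
    by rewrite mulVf// gt_eqF ?b_gt0.
  exists (fun i => if unlift ord0 i is Some j then e j else u) => i j.
  case: (unliftP ord0 i) => [i'|] ->; case: (unliftP ord0 j) => [j'|] ->.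
  - by rewrite oe (inj_eq lift_inj).
  - by rewrite b_sym ou eq_sym (negbTE (neq_lift _ _)).
  - by rewrite ou (negbTE (neq_lift _ _)).
  - by rewrite uu eqxx.
exists e; split => // x.
pose E := [tuple e i | i < \dim {:W}].
have EE (i : 'I_(\dim {:W})) : E`_i = e i by rewrite -tnth_nth tnth_mktuple.
have bE : basis_of fullv E.
  rewrite basisEfree subvf size_tuple leqnn !andbT; apply/freeP => k kE i.
  have : b (\sum_i k i *: E`_i) (e i) = 0 by rewrite kE b0.
  rewrite bs (bigD1 i)//= big1 => [|j ji].
    by rewrite bZ EE oe eqxx mulr1 addr0.
  by rewrite bZ EE oe (negbTE ji) mulr0.
have xE := coord_basis bE (memvf x); rewrite {1}xE; apply: eq_bigr => i _.
rewrite EE {2}xE bs (bigD1 i)//= big1 => [|j ji].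
  by rewrite bZ EE oe eqxx mulr1 addr0.
by rewrite bZ EE oe (negbTE ji) mulr0.
Qed.
End InnerProduct.

(** * Directional derivatives and smooth maps *)

Section LinearFunctions.
Context (R : pzRingType) (W W' : lmodType R) (f : W -> W').
Hypothesis lf : linear f.

Lemma linear_funB x y : f (x - y) = f x - f y.
Proof. by rewrite addrC -scaleN1r lf scaleN1r addrC. Qed.

Lemma linear_fun0 : f 0 = 0.
Proof. by rewrite -(subrr 0) linear_funB subrr. Qed.

Lemma linear_funZ a x : f (a *: x) = a *: f x.
Proof. by rewrite -[a *: x]addr0 lf linear_fun0 addr0. Qed.

Lemma linear_funD x y : f (x + y) = f x + f y.
Proof. by have := lf 1 x y; rewrite !scale1r. Qed.

Lemma linear_fun_sum n (c : 'I_n -> R) (x : 'I_n -> W) :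
  f (\sum_i c i *: x i) = \sum_i c i *: f (x i).
Proof.
elim: n c x => [|n IH] c x; first by rewrite !big_ord0 linear_fun0.
by rewrite !big_ord_recl linear_funD linear_funZ IH.
Qed.

End LinearFunctions.

Section DirectionalDerivatives.
Context (R : realType) (V W : normedModType R).
Implicit Types (f : V -> W) (x v : V).

Lemma is_derive_cvg f x v (l : W) : is_derive x v f l ->
  h^-1 *: (f (h *: v + x) - f x) @[h --> (0 : R)^'] --> l.
Proof. by move=> [df <-]. Qed.
Arguments is_derive_cvg {f x v l} _ _ _.

Lemma cvg_is_derive f x v (l : W) :
  h^-1 *: (f (h *: v + x) - f x) @[h --> (0 : R)^'] --> l -> is_derive x v f l.
Proof. by move=> fl; split; [apply/cvg_ex; exists l | exact: cvg_lim fl]. Qed.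

End DirectionalDerivatives.

Section DerivativeRules.
Context (R : realType) (V W W' : normedModType R).
Implicit Types (f g : V -> W) (a : V -> R) (x v : V).

Lemma near_eq_continuous_at f g x : {near x, f =1 g} ->
  {for x, continuous f} -> {for x, continuous g}.
Proof.
move=> fg cf; suff : g @ x --> g x by [].
rewrite -(nbhs_singleton fg); apply: cvg_trans cf.
by apply: near_eq_cvg; exact: fg.
Qed.

Lemma cvg_line g x v : {for x, continuous g} ->
  g (h *: v + x) @[h --> (0 : R)^'] --> g x.
Proof.
move=> cg; have : h *: v + x @[h --> (0 : R)^'] --> 0 *: v + x.
  apply: cvgD; last exact: cvg_cst.
  by apply: cvgZr_tmp; apply: cvg_within_filter; exact: cvg_id.
by rewrite scale0r add0r => /cvg_comp; exact.
Qed.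

Lemma is_derive_scale a g x v (da : R) (dg : W) : {for x, continuous g} ->
  is_derive x v a da -> is_derive x v g dg ->
  is_derive x v (fun y => a y *: g y) (da *: g x + a x *: dg).
Proof.
move=> cg /is_derive_cvg ha /is_derive_cvg hg; apply: cvg_is_derive.
rewrite [X in X @ _ --> _](_ : _ = fun h : R =>
  (h^-1 *: (a (h *: v + x) - a x)) *: g (h *: v + x) +
  a x *: (h^-1 *: (g (h *: v + x) - g x))); last first.
  apply/funext => h; rewrite -[h^-1 *: (a _ - a _)]/(h^-1 * _) -scalerA.
  have C (r t : R) (w : W) : r *: (t *: w) = t *: (r *: w).
    by rewrite !scalerA mulrC.
  by rewrite (C (a x)) -scalerDr; congr (_ *: _); rewrite scalerBl scalerBr addrA subrK.
by apply: cvgD; [apply: cvgZ => //; exact: cvg_line | exact: cvgZl_tmp].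
Qed.

Lemma is_derive_linear (l : W -> W') f x v (df : W) : linear l -> continuous l ->
  is_derive x v f df -> is_derive x v (l \o f) (l df).
Proof.
move=> ll cl /is_derive_cvg hf; apply: cvg_is_derive.
rewrite [X in X @ _ --> _](_ : _ = fun h : R =>
  l (h^-1 *: (f (h *: v + x) - f x))); first exact: (cvg_comp _ _ hf (cl df)).
by apply/funext => h; rewrite (linear_funZ ll) (linear_funB ll).
Qed.

End DerivativeRules.

Section Smooth.
Context (R : realType) (V : normedModType R).

(** The set is named here, whereas [smooth_at] hides a neighbourhood: a function and all its
    derivatives can then be treated on one common domain. *)
Definition smooth_in (W : normedModType R) (U : set V) (f : V -> W) :=
  forall y, U y -> forall vs,
    {for y, continuous (iter_derive f vs)} /\
    forall v, derivable (iter_derive f vs) y v.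

Lemma smooth_atP (W : normedModType R) (f : V -> W) x :
  smooth_at f x <-> exists U, [/\ open U, U x & smooth_in U f].
Proof.
split => [fx|[U [oU Ux fU]]].
  exists (interior [set y | forall vs : seq V,
    {for y, continuous (iter_derive f vs)} /\
    forall v, derivable (iter_derive f vs) y v]).
  by split => // [|y /interior_subset]; [exact: open_interior|exact].
by apply: filterS (open_nbhs_nbhs (conj oU Ux)) => y Uy; exact: fU.
Qed.

Context (U : set V) (oU : open U).

Lemma near_open y : U y -> \forall z \near y, U z.
Proof. by move=> Uy; exact: open_nbhs_nbhs. Qed.


Lemma smooth_in_is_derive (W : normedModType R) (f : V -> W) y v :
  smooth_in U f -> U y ->
  is_derive y v f ('D_v f y).
Proof. by move=> fU Uy; apply/derivableP; have [_] := fU y Uy [::]; exact. Qed.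

Lemma smooth_in_continuous (W : normedModType R) (f : V -> W) y :
  smooth_in U f -> U y -> {for y, continuous f}.
Proof. by move=> fU Uy; have [+ _] := fU y Uy [::]. Qed.

Lemma smooth_in_derive (W : normedModType R) (f : V -> W) v :
  smooth_in U f -> smooth_in U ('D_v f).
Proof.
move=> fU y Uy vs; have := fU y Uy (rcons vs v).
by rewrite /iter_derive foldr_rcons.
Qed.

Lemma iter_derive_eq (W : normedModType R) (f g : V -> W) vs :
  (forall y, U y -> f y = g y) ->
  forall y, U y -> iter_derive f vs y = iter_derive g vs y.
Proof.
move=> fg; elim: vs => [|v vs IH] y Uy /=; first exact: fg.
by apply: near_eq_derive; apply: filterS (near_open Uy) => z Uz; exact: IH.
Qed.

(* A class of functions stable under directional differentiation on [U] consists
   of smooth functions; all closure properties below are instances. *)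
Lemma smooth_in_coind (W : normedModType R) (C : set (V -> W)) :
  (forall f, C f -> (forall y, U y -> {for y, continuous f}) /\
     forall v, exists2 f', C f' & forall y, U y -> is_derive y v f (f' y)) ->
  forall f, C f -> smooth_in U f.
Proof.
(* The innermost derivative is the last entry of [vs], so induction from the end replaces [f] by a
   derivative in the class, which agrees with ['D_v f] on [U] only. *)
move=> CP f Cf y Uy vs; elim/last_ind: vs f Cf => [|vs v IH] f Cf.
  have [cf df] := CP f Cf; split => [|v]; first exact: cf.
  by have [f' _ /(_ _ Uy)[]] := df v.
have [_ /(_ v)[f' Cf' ff']] := CP f Cf.
rewrite /iter_derive foldr_rcons -/(iter_derive _ vs).
have E : forall z, U z -> iter_derive f' vs z = iter_derive ('D_v f) vs z.
  by apply: iter_derive_eq => z Uz; have [_ ->] := ff' z Uz.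
have nE : {near y, iter_derive f' vs =1 iter_derive ('D_v f) vs}.
  by apply: filterS (near_open Uy) => z Uz; exact: E.
have [cf df] := IH f' Cf'; split => [|w]; last exact: (near_eq_derivable nE).
exact: near_eq_continuous_at cf.
Qed.

Lemma eq_smooth_in (W : normedModType R) (f g : V -> W) :
  (forall y, U y -> f y = g y) ->
  smooth_in U f -> smooth_in U g.
Proof.
move=> fg fU; pose C := [set g : V -> W | exists2 f : V -> W, smooth_in U f &
  forall y, U y -> f y = g y].
suff : forall g : V -> W, C g -> smooth_in U g by apply; exists f.
apply: smooth_in_coind => {fg fU}f' [{}f fU ff']; split => [y Uy|v].
  apply: near_eq_continuous_at (smooth_in_continuous fU Uy).
  by apply: filterS (near_open Uy) => z Uz; exact: ff'.
exists ('D_v f); first by exists ('D_v f) => //; exact: smooth_in_derive.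
move=> y Uy; apply: near_eq_is_derive (smooth_in_is_derive v fU Uy).
by apply: filterS (near_open Uy) => z Uz; exact: ff'.
Qed.

Lemma smooth_in_cst (W : normedModType R) (w : W) : smooth_in U (fun=> w).
Proof.
apply: (smooth_in_coind (C := range (fun w _ => w))); last by exists w.
move=> _ [{}w _ <-]; split => [y _|v]; first exact: cst_continuous.
by exists (fun=> 0) => [|y _]; [exists 0|exact: is_derive_cst].
Qed.

Lemma smooth_in_add (W : normedModType R) (f g : V -> W) :
  smooth_in U f -> smooth_in U g ->
  smooth_in U (fun z => f z + g z).
Proof.
move=> fU gU; apply: (smooth_in_coind (C := [set F | exists f g,
  [/\ smooth_in U f, smooth_in U g & F = f \+ g]])); last by exists f, g.
move=> _ [{fU}f [{gU}g [fU gU ->]]]; split => [y Uy|v].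
  by apply: cvgD; exact: smooth_in_continuous.
exists ('D_v f \+ 'D_v g) => [|y Uy].
  by exists ('D_v f), ('D_v g); split => //; exact: smooth_in_derive.
by apply: is_deriveD; exact: smooth_in_is_derive.
Qed.

(** By the Leibniz rule, single products are not stable under differentiation but their finite sums
    are, as [smooth_in_coind] asks. *)
Inductive sums_of_products (W : normedModType R) : set (V -> W) :=
| sums_of_products_scale a g of smooth_in U a & smooth_in U g :
    sums_of_products (fun z : V => (a z : R) *: g z)
| sums_of_products_add f g of sums_of_products f & sums_of_products g :
    sums_of_products (fun z => f z + g z).

Lemma smooth_in_scale (W : normedModType R) (a : V -> R) (g : V -> W) :
  smooth_in U a -> smooth_in U g ->
  smooth_in U (fun z => (a z : R) *: g z).
Proof.
move=> aU gU; apply: (@smooth_in_coind W (@sums_of_products W)); last first.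
  exact: sums_of_products_scale.
move=> F; elim=> {F} [{}a {}g {}aU {}gU|f {aU gU}g _ [cf df] _ [cg dg]].
  split => [y Uy|v]; first by apply: cvgZ; exact: smooth_in_continuous.
  exists (fun z => 'D_v a z *: g z + a z *: 'D_v g z).
    apply: sums_of_products_add; apply: sums_of_products_scale.
    - exact: smooth_in_derive aU.
    - exact: gU.
    - exact: aU.
    - exact: smooth_in_derive gU.
  by move=> y Uy; apply: is_derive_scale; [exact: smooth_in_continuous|
    exact: smooth_in_is_derive|exact: smooth_in_is_derive].
split => [y Uy|v]; first by apply: cvgD; [exact: cf|exact: cg].
have [f' sf' ff'] := df v; have [g' sg' gg'] := dg v.
exists (fun z => f' z + g' z); first exact: sums_of_products_add.
by move=> y Uy; apply: is_deriveD; [exact: ff'|exact: gg'].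
Qed.


Lemma smooth_in_comp_linear (W W' : normedModType R) (l : W -> W') (f : V -> W) :
  linear l -> continuous l -> smooth_in U f -> smooth_in U (l \o f).
Proof.
move=> ll cl fU; apply: (smooth_in_coind (C := [set F | exists2 f,
  smooth_in U f & F = l \o f])); last by exists f.
move=> _ [{fU}f fU ->]; split => [y Uy|v].
  by apply: continuous_comp; [exact: smooth_in_continuous|exact: cl].
exists (l \o 'D_v f); first by exists ('D_v f) => //; exact: smooth_in_derive.
move=> y Uy; apply: is_derive_linear => //; exact: smooth_in_is_derive.
Qed.

Lemma smooth_in_linear (W : normedModType R) (l : V -> W) :
  linear l -> continuous l -> smooth_in U l.
Proof.
move=> ll cl; apply: (smooth_in_comp_linear (f := id)) => //.
apply: (smooth_in_coind (C := [set f | smooth_in U f \/ f = id])); last by right.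
move=> f Cf; split => [y Uy|v].
  by case: Cf => [fU|->]; [exact: smooth_in_continuous|exact: cvg_id].
case: Cf => [fU|->].
  exists ('D_v f); first by left; exact: smooth_in_derive.
  by move=> y Uy; exact: smooth_in_is_derive.
exists (fun=> v); first by left; exact: smooth_in_cst.
by move=> y Uy; exact: is_derive_id.
Qed.

End Smooth.

(** * Hadamard's lemma *)

Lemma continuous_sum (R : realType) (T : topologicalType) (W : normedModType R)
    n (f : 'I_n -> T -> W) x : (forall i, {for x, continuous (f i)}) ->
  {for x, continuous (fun y => \sum_i f i y)}.
Proof.
move=> cf; change (continuous_at x (fun y => \sum_i f i y)); elim: n f cf => [|n IH] f cf.
  by under eq_fun do rewrite big_ord0; exact: cst_continuous.
under eq_fun do rewrite big_ord_recl; apply: cvgD; first exact: cf.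
exact: (IH (fun i => f (lift ord0 i))).
Qed.

(** * Integrals over [0, 1] and uniformity in a parameter *)

Section UnitIntervalIntegral.
Context (R : realType).
Notation mu := (@lebesgue_measure R).
Implicit Types f g : R -> R.

Let integrable01 f : {in `[0, 1], continuous f} -> mu.-integrable `[0, 1] (EFin \o f).
Proof.
move=> cf; apply: continuous_compact_integrable; first exact: segment_compact.
by apply: continuous_in_subspaceT => t /set_mem t01; exact: cf.
Qed.

(** The interval has length 1, so a bound on the integrands passes unchanged to the integrals.
    Continuity of a parametric integral and differentiation under the integral sign both reduce to
    this estimate. *)
Lemma dist_integral01 f g (eps : R) : {in `[0, 1], continuous f} ->
  {in `[0, 1], continuous g} -> (forall t : R, t \in `[0, 1] -> `|f t - g t| <= eps) ->
  `|\int[mu]_(t in `[0, 1]) f t - \int[mu]_(t in `[0, 1]) g t| <= eps.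
Proof.
move=> cf cg fg.
have cfg : {in `[0, 1], continuous (f \- g)}.
  by move=> t t01; apply: cvgB; [exact: cf|exact: cg].
rewrite -RintegralB//; [|exact: integrable01..].
apply: le_trans (le_normr_Rintegral _ _) _ => //; first exact: integrable01.
have -> : eps = \int[mu]_(t in `[0, 1]) cst eps t.
  by rewrite Rintegral_cst//= lebesgue_measure_itv/= lte_fin ltr01/= subr0 mulr1.
apply: le_Rintegral => //.
- apply: (@integrable01 (fun t => `|f t - g t|)) => t t01.
  by apply: cvg_norm; exact: cfg.
- by apply: (@integrable01 (cst eps)) => t _; exact: cst_continuous.
Qed.

Lemma integral01B f g : {in `[0, 1], continuous f} -> {in `[0, 1], continuous g} ->
  \int[mu]_(t in `[0, 1]) (f t - g t) =
  \int[mu]_(t in `[0, 1]) f t - \int[mu]_(t in `[0, 1]) g t.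
Proof. by move=> cf cg; rewrite RintegralB//; exact: integrable01. Qed.

Lemma integral01_sum n (f : 'I_n -> R -> R) :
  (forall i, {in `[0, 1], continuous (f i)}) ->
  \int[mu]_(t in `[0, 1]) (\sum_i f i t) = \sum_i \int[mu]_(t in `[0, 1]) f i t.
Proof.
move=> cf; elim: n f cf => [|n IH] f cf.
  by under eq_Rintegral do rewrite big_ord0; rewrite Rintegral_cst// mul0r big_ord0.
under eq_Rintegral do rewrite big_ord_recl; rewrite big_ord_recl -IH//.
rewrite RintegralD//; first exact: integrable01.
apply: (@integrable01 (fun t => \sum_(i < n) f (lift ord0 i) t)) => t t01.
by apply: continuous_sum => i; exact: cf.
Qed.

Lemma integral01Zl c f : {in `[0, 1], continuous f} ->
  \int[mu]_(t in `[0, 1]) (c * f t) = c * \int[mu]_(t in `[0, 1]) f t.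
Proof. by move=> cf; rewrite RintegralZl//; exact: integrable01. Qed.

Lemma integral01_derive f g : (forall t : R, t \in `[0, 1] -> is_derive t 1 f (g t)) ->
  {in `[0, 1], continuous g} -> \int[mu]_(t in `[0, 1]) g t = f 1 - f 0.
Proof.
move=> fg cg; have cf (t : R) : t \in `[0, 1] -> {for t, continuous f}.
  move=> t01; apply: differentiable_continuous; apply/derivable1_diffP.
  by have [] := fg t t01.
rewrite /Rintegral (@continuous_FTC2 _ g f 0 1)//.
- by apply: continuous_in_subspaceT => t /set_mem t01; exact: cg.
- split => [t t01||].
  + by have [] := fg t (subset_itv_oo_cc t01).
  + by apply: cvg_at_right_filter; apply: cf; rewrite in_itv/= lexx ler01.
  + by apply: cvg_at_left_filter; apply: cf; rewrite in_itv/= lexx ler01.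
- by move=> t t01; rewrite derive1E; have [_] := fg t (subset_itv_oo_cc t01).
Qed.

(** Tube lemma: around each (x, t) there is a box on which [phi] stays within eps / 2 of [phi x t],
    and compactness of [0, 1] yields one neighbourhood of [x] good for all times. *)
Lemma near_uniform01 (T : topologicalType) (phi : T -> R -> R) x :
  (forall t : R, t \in `[0, 1] -> {for (x, t), continuous (fun z : T * R => phi z.1 z.2)}) ->
  forall eps : R, 0 < eps ->
  \forall y \near x, forall t : R, t \in `[0, 1] -> `|phi y t - phi x t| < eps.
Proof.
move=> cphi eps eps0.
have := iffLR (compact_near_coveringP _) (@segment_compact R 0 1).
move=> /(_ _ (nbhs x) (fun y t => `|phi y t - phi x t| < eps) _); apply => t t01.
have e2 : 0 < eps / 2 by rewrite divr_gt0.
have /cvgrPdist_lt/(_ _ e2) := cphi t t01.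
case => -[A B] /= [xA tB] AB.
exists (B, A) => // -[s y] /= [Bs Ay].
have xs : A x by exact: nbhs_singleton.
(* Both [phi y s] and [phi x s] are compared with the value at the centre (x, t) of the box, whence
   the two halves of [eps]. *)
have H1 := AB (y, s) (conj Ay Bs); have H2 := AB (x, s) (conj xs Bs).
rewrite /= in H1 H2; rewrite (splitr eps).
rewrite -(subrK (phi x t) (phi y s)) -addrA.
by apply: le_lt_trans (ler_normD _ _) _; apply: ltrD; rewrite // distrC.
Qed.

End UnitIntervalIntegral.

(** * Derivatives along lines and linearity in the direction *)

Section LineDerivative.
Context (R : realType) (V : normedModType R).

Lemma is_derive_line (W : normedModType R) (f : V -> W) x u s (df : W) :
  is_derive (x + s *: u) u f df -> is_derive s 1 (fun t => f (x + t *: u)) df.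
Proof.
move=> /is_derive_cvg hf; apply: cvg_is_derive.
rewrite [X in X @ _ --> _](_ : _ = fun h : R =>
  h^-1 *: (f (h *: u + (x + s *: u)) - f (x + s *: u)))//.
apply/funext => h; do 3 f_equal.
by rewrite -[h *: 1]/(h * 1) mulr1 scalerDl addrCA.
Qed.

Lemma is_derive_scale_dir (W : normedModType R) (f : V -> W) x v a (df : W) :
  is_derive x v f df -> is_derive x (a *: v) f (a *: df).
Proof.
move=> fx; have [->|a0] := eqVneq a 0; first by rewrite !scale0r; exact: is_derive0.
move/is_derive_cvg in fx; apply: cvg_is_derive.
rewrite [X in X @ _ --> _](_ : _ = fun h : R =>
  a *: ((h * a)^-1 *: (f ((h * a) *: v + x) - f x))); last first.
  apply/funext => h; rewrite !scalerA; congr (_ *: _).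
  by rewrite invfM mulrCA mulfV// mulr1.
apply: cvgZl_tmp; move/cvgrPdist_lt in fx; apply/cvgrPdist_lt => e e0.
have [d /= d0 H] := fx e e0; exists (d / `|a|) => [|h /= hd h0].
  by rewrite /= divr_gt0// normr_gt0.
apply: H => /=; last by rewrite mulf_neq0.
by move: hd; rewrite !sub0r !normrN normrM ltr_pdivlMr ?normr_gt0.
Qed.

Lemma mvt_line (f : V -> R) x u :
  (forall s : R, s \in `[0, 1] -> derivable f (x + s *: u) u) ->
  exists2 c : R, c \in `[0, 1] & f (x + u) - f x = 'D_u f (x + c *: u).
Proof.
move=> df; pose g (t : R) := f (x + t *: u).
have dg (s : R) : s \in `[0, 1] -> is_derive s 1 g ('D_u f (x + s *: u)).
  by move=> s01; apply: is_derive_line; apply/derivableP; exact: df.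
have dg' (s : R) : s \in `]0, 1[ -> is_derive s 1 g ('D_u f (x + s *: u)).
  by move=> s01; apply: dg; exact: subset_itv_oo_cc.
have cg : {within `[0, 1], continuous g}.
  apply: continuous_in_subspaceT => s /set_mem s01.
  apply: differentiable_continuous; apply/derivable1_diffP.
  by have [] := dg s s01.
have [c c01] := MVT_segment ler01 dg' cg.
rewrite /g scale1r scale0r addr0 subr0 mulr1 => gE; exists c => //.
Qed.
End LineDerivative.

Lemma near_dnbhs0 (R : realType) (P Q : R -> Prop) :
  (forall h, h != 0 -> P h -> Q h) -> (\forall h \near (0 : R), P h) ->
  \forall h \near 0^', Q h.
Proof. by move=> PQ; apply: filterS => h Ph h0; exact: PQ. Qed.

Section SegmentDerivative.
Context (R : realType) (V : normedModType R) (U : set V) (oU : open U).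
Implicit Types (y u v : V).

Lemma near_segment (A : set V) y u v : nbhs y A ->
  \forall h \near (0 : R), forall c : R, c \in `[0, 1] ->
    A (h *: u + y + c *: (h *: v)).
Proof.
move=> /nbhs_ballP[e /= e0 eA]; have D0 : 0 < `|u| + `|v| + 1.
  by rewrite ltr_wpDl ?addr_ge0.
(* The summand 1 keeps the denominator positive when [u] and [v] both vanish. *)
exists (e / (`|u| + `|v| + 1)); first by rewrite /= divr_gt0.
move=> h; rewrite /= sub0r normrN ltr_pdivlMr// => he c.
rewrite in_itv/= => /andP[c0 c1]; apply: eA; rewrite -ball_normE /=.
rewrite [h *: u + y]addrC -addrA opprD addNKr normrN.
apply: le_lt_trans (ler_normD _ _) (le_lt_trans _ he).
rewrite !normrZ (ger0_norm c0) mulrDr mulrDr mulr1 -addrA lerD2l.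
by rewrite ler_wpDr// ler_piMl// mulr_ge0.
Qed.

Lemma near_increment (F : V -> R) y u v e : smooth_in U F -> U y -> 0 < e ->
  \forall h \near (0 : R),
    `|F (h *: u + y + h *: v) - F (h *: u + y) - h * 'D_v F y| <= `|h| * e.
Proof.
move=> FU Uy e0; have cD := smooth_in_continuous (smooth_in_derive v FU) Uy.
move/cvgrPdist_lt : cD => /(_ e e0) nD.
have nU : nbhs y U by exact: open_nbhs_nbhs.
near=> h.
have hU : forall c : R, c \in `[0, 1] -> U (h *: u + y + c *: (h *: v)).
  by near: h; exact: near_segment.
have hD : forall c : R, c \in `[0, 1] ->
    `|'D_v F y - 'D_v F (h *: u + y + c *: (h *: v))| < e.
  by near: h; exact: (@near_segment [set z | `|'D_v F y - 'D_v F z| < e]).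
have dF c : c \in `[0, 1] -> is_derive (h *: u + y + c *: (h *: v)) (h *: v) F
    (h *: 'D_v F (h *: u + y + c *: (h *: v))).
  by move=> c01; apply: is_derive_scale_dir; apply: smooth_in_is_derive FU (hU c c01).
have [c c01 ->] : exists2 c : R, c \in `[0, 1] &
    F (h *: u + y + h *: v) - F (h *: u + y) =
    'D_(h *: v) F (h *: u + y + c *: (h *: v)).
  by apply: mvt_line => c c01; have [] := dF c c01.
have [_ ->] := dF c c01; rewrite -[h *: 'D_v _ _]/(h * _) -mulrBr normrM.
by rewrite ler_wpM2l// distrC ltW// hD.
Unshelve. all: end_near. Qed.

(** Additivity in the direction is not automatic for directional derivatives. The path from y to y +
    h(u + v) goes through y + h u; on its second leg the base point moves with h, and
    [near_increment] controls it by the mean value theorem and the continuity of ['D_v F]. *)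
Lemma smooth_in_deriveD (F : V -> R) y u v : smooth_in U F -> U y ->
  'D_(u + v) F y = 'D_u F y + 'D_v F y.
Proof.
move=> FU Uy; suff [_] : is_derive y (u + v) F ('D_u F y + 'D_v F y) by [].
have hu := is_derive_cvg (smooth_in_is_derive u FU Uy).
apply: cvg_is_derive.
rewrite [X in X @ _ --> _](_ : _ = fun h : R =>
  h^-1 *: (F (h *: u + y) - F y) +
  h^-1 *: (F (h *: u + y + h *: v) - F (h *: u + y))); last first.
  by apply/funext => h; rewrite -scalerDr; congr (_ *: _);
    rewrite scalerDr addrAC [RHS]addrC addrA subrK.
apply: cvgD; first exact: hu.
apply/cvgrPdist_le => e e0.
apply: near_dnbhs0 (near_increment u v FU Uy e0) => h h0; rewrite distrC => H.
have hgt0 : 0 < `|h| by rewrite normr_gt0.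
rewrite -(ler_pM2l hgt0) -normrM mulrBr -[h^-1 *: _]/(h^-1 * _) mulrA.
by rewrite mulfV// mul1r.
Qed.

Lemma smooth_in_derive_sum (F : V -> R) y n (u : 'I_n -> V) : smooth_in U F ->
  U y -> 'D_(\sum_i u i) F y = \sum_i 'D_(u i) F y.
Proof.
move=> FU Uy; elim: n u => [|n IH] u; first by rewrite !big_ord0 derive0.
by rewrite !big_ord_recl smooth_in_deriveD// IH.
Qed.

Lemma smooth_in_deriveZ (F : V -> R) y a u : smooth_in U F -> U y ->
  'D_(a *: u) F y = a * 'D_u F y.
Proof.
by move=> FU Uy; have [] := is_derive_scale_dir a (smooth_in_is_derive u FU Uy).
Qed.

End SegmentDerivative.

Section Hadamard.
Context (R : realType) (V : normedModType R) (U : set V) (oU : open U).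
Hypothesis starU : forall x (t : R), U x -> t \in `[0, 1] -> U (t *: x).
Notation mu := (@lebesgue_measure R).

(** Differentiating F(t x) in x brings out a factor t. The weight [w] absorbs it, which makes the
    family of these integrals stable under differentiation. *)
Definition radial_integral (w : R -> R) (F : V -> R) (x : V) : R :=
  \int[mu]_(t in `[0, 1]) (w t * F (t *: x)).

Let integrand_continuous (w : R -> R) (F : V -> R) : continuous w -> smooth_in U F ->
  forall x (t : R), U x -> t \in `[0, 1] ->
  {for (x, t), continuous (fun z : V * R => w z.2 * F (z.2 *: z.1))}.
Proof.
move=> cw FU x t Ux t01.
apply: cvgM.
  by apply: (@continuous_comp _ _ _ snd w); [exact: cvg_snd|exact: cw].
apply: (@continuous_comp _ _ _ (fun z : V * R => z.2 *: z.1) F).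
  by apply: cvgZ; [exact: cvg_snd|exact: cvg_fst].
by apply: smooth_in_continuous FU _; exact: starU.
Qed.

Let integrand_continuous2 (w : R -> R) (F : V -> R) : continuous w -> smooth_in U F ->
  forall x, U x -> {in `[0, 1], continuous (fun t => w t * F (t *: x))}.
Proof.
move=> cw FU x Ux t t01; apply: cvgM; first exact: cw.
apply: (@continuous_comp _ _ _ (fun t : R => t *: x) F).
  by apply: cvgZr_tmp; exact: cvg_id.
by apply: smooth_in_continuous FU _; exact: starU.
Qed.

Lemma radial_integral_continuous w F x : continuous w -> smooth_in U F -> U x ->
  {for x, continuous (radial_integral w F)}.
Proof.
move=> cw FU Ux; apply/cvgrPdist_le => e e0.
have unif := near_uniform01 (phi := fun y t => w t * F (t *: y))
  (fun t t01 => integrand_continuous cw FU Ux t01) e0.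
apply: filterS2 unif (near_open oU Ux) => y xy Uy; apply: dist_integral01.
- exact: integrand_continuous2.
- exact: integrand_continuous2.
- by move=> t t01; rewrite distrC ltW// xy.
Qed.

(** For each t, the mean value theorem writes the increment of F(t x) through the derivative at an
    intermediate point between x and x + h v. That point depends on t, so the error is bounded by
    the uniform estimate [near_uniform01] rather than pointwise. *)
Lemma is_derive_radial_integral w F x v : continuous w -> smooth_in U F -> U x ->
  is_derive x v (radial_integral w F) (radial_integral (fun t => t * w t) ('D_v F) x).
Proof.
move=> cw FU Ux; have DU := smooth_in_derive v FU.
have cw' : continuous (fun t : R => t * w t).
  by move=> t; apply: cvgM; [exact: cvg_id|exact: cw].
apply: cvg_is_derive; apply/cvgrPdist_le => e e0.
have unif := near_uniform01 (phi := fun y t => t * w t * 'D_v F (t *: y))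
  (fun t t01 => integrand_continuous cw' DU Ux t01) e0.
have nU : nbhs x U by exact: open_nbhs_nbhs.
have h1 := near_segment 0 v (@filterI _ (nbhs x) (nbhs_filter x) _ _ nU unif).
apply: near_dnbhs0 h1 => h h0 h1.
have Uh : U (h *: v + x).
  have [] := h1 1; first by rewrite in_itv/= ler01 lexx.
  by rewrite scaler0 add0r scale1r addrC.
have hgt0 : 0 < `|h| by rewrite normr_gt0.
rewrite -(ler_pM2l hgt0) -normrM mulrBr -[h^-1 *: _]/(h^-1 * _) mulrA mulfV// mul1r.
have cphi := integrand_continuous2 cw FU.
have cpsi := integrand_continuous2 cw' DU.
rewrite -integral01Zl; last exact: cpsi.
rewrite -integral01B; [|exact: cphi|exact: cphi].
apply: dist_integral01 => [t t01|t t01|t t01].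
- by apply: cvgM; [exact: cvg_cst|exact: cpsi].
- by apply: cvgB; exact: cphi.
rewrite -mulrBr.
have E (s : R) : t *: x + s *: (t *: (h *: v)) = t *: (h *: 0 + x + s *: (h *: v)).
  by rewrite scaler0 add0r scalerDr !scalerA [s * t]mulrC.
have dF s : s \in `[0, 1] -> is_derive (t *: x + s *: (t *: (h *: v)))
    (t *: (h *: v)) F (t *: (h *: 'D_v F (t *: (h *: 0 + x + s *: (h *: v))))).
  move=> s01; apply: is_derive_scale_dir; apply: is_derive_scale_dir.
  rewrite E; apply: smooth_in_is_derive FU _; apply: starU => //.
  by have [] := h1 s s01.
have [c c01 FE] : exists2 c : R, c \in `[0, 1] &
    F (t *: x + t *: (h *: v)) - F (t *: x) =
    'D_(t *: (h *: v)) F (t *: x + c *: (t *: (h *: v))).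
  by apply: mvt_line => c c01; have [] := dF c c01.
rewrite [h *: v + x]addrC scalerDr FE; have [_ ->] := dF c c01.
rewrite -[t *: (h *: _)]/(t * (h * _)); set B := 'D_v F (t *: (_ + _)).
have -> : h * (t * w t * 'D_v F (t *: x)) - w t * (t * (h * B)) =
    h * (t * w t * 'D_v F (t *: x) - t * w t * B) by ring.
rewrite normrM ler_wpM2l//.
have [_ /(_ t t01)/ltW] := h1 c c01.
by rewrite distrC.
Qed.

Lemma smooth_in_radial_integral w F : continuous w -> smooth_in U F ->
  smooth_in U (radial_integral w F).
Proof.
move=> cw FU; apply: (smooth_in_coind oU (C := [set K | exists w F,
  [/\ continuous w, smooth_in U F & K = radial_integral w F]])); last by exists w, F.
move=> _ [{cw}w [{FU}F [cw FU ->]]]; split => [y Uy|v].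
  exact: radial_integral_continuous.
exists (radial_integral (fun t => t * w t) ('D_v F)).
  exists (fun t => t * w t), ('D_v F); split; [|exact: smooth_in_derive|by []].
  by move=> t; apply: cvgM; [exact: cvg_id|exact: cw].
by move=> y Uy; exact: is_derive_radial_integral.
Qed.

(* [a x] is the integral over [0, 1] of the derivative of [t |-> a (t x)]. *)
Lemma hadamard n (c : 'I_n -> V -> R) (e : 'I_n -> V) (a : V -> R) :
  (forall x, x = \sum_i c i x *: e i) -> smooth_in U a -> a 0 = 0 ->
  exists b : 'I_n -> V -> R, (forall i, smooth_in U (b i)) /\
    forall x, U x -> a x = \sum_i c i x * b i x.
Proof.
move=> cE aU a0; exists (fun i => radial_integral (fun=> 1) ('D_(e i) a)).
have cst1 : continuous (fun _ : R => 1 : R) by move=> t; exact: cvg_cst.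
split => [i|x Ux].
  by apply: smooth_in_radial_integral; [exact: cst1|exact: smooth_in_derive].
have Utx (t : R) : t \in `[0, 1] -> U (0 + t *: x).
  by move=> t01; rewrite add0r; exact: starU.
have cD i : {in `[0, 1], continuous (fun t : R => 'D_(e i) a (0 + t *: x))}.
  move=> t t01; apply: (@continuous_comp _ _ _ (fun t : R => 0 + t *: x) ('D_(e i) a)).
    by apply: cvgD; [exact: cvg_cst|apply: cvgZr_tmp; exact: cvg_id].
  by apply: smooth_in_continuous (Utx t t01); exact: smooth_in_derive.
have DE (t : R) : t \in `[0, 1] ->
    'D_x a (0 + t *: x) = \sum_i c i x * 'D_(e i) a (0 + t *: x).
  move=> t01; have := smooth_in_derive_sum oU (fun i => c i x *: e i) aU (Utx t t01).
  rewrite -cE => ->.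
  by apply: eq_bigr => i _; rewrite (smooth_in_deriveZ _ _ aU (Utx t t01)).
have -> : a x = a (0 + 1 *: x) - a (0 + 0 *: x).
  by rewrite scale1r scale0r !add0r a0 subr0.
pose g (t : R) := \sum_i c i x * 'D_(e i) a (0 + t *: x).
have dg (t : R) : t \in `[0, 1] -> is_derive t 1 (fun t => a (0 + t *: x)) (g t).
  move=> t01; rewrite /g -DE//; apply: is_derive_line.
  exact: smooth_in_is_derive aU (Utx t t01).
have cg : {in `[0, 1], continuous g}.
  move=> t t01; apply: continuous_sum => i.
  by apply: cvgM; [exact: cvg_cst|exact: cD].
rewrite -(integral01_derive dg cg) integral01_sum => [|i t t01]; last first.
  by apply: cvgM; [exact: cvg_cst|exact: cD].
apply: eq_bigr => i _; rewrite integral01Zl; last exact: cD.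
by congr (_ * _); apply: eq_Rintegral => t _; rewrite mul1r add0r.
Qed.

End Hadamard.

(** * Homogeneous polynomial maps *)

Lemma smooth_in_subset (R : realType) (V W : normedModType R) (U U' : set V) (f : V -> W) :
  U' `<=` U -> smooth_in U f -> smooth_in U' f.
Proof. by move=> sU fU y /sU /fU. Qed.

Section SmoothGerms.
Context (R : realType) (V W : normedModType R).

Lemma smooth_at_scale (a : V -> R) (f : V -> W) x :
  smooth_at a x -> smooth_at f x -> smooth_at (fun z => a z *: f z) x.
Proof.
move=> /smooth_atP[U [oU Ux aU]] /smooth_atP[U' [oU' Ux' fU']].
apply/smooth_atP; exists (U `&` U'); split => //; first exact: openI.
by apply: smooth_in_scale; [exact: openI|exact: smooth_in_subset aU|
  exact: smooth_in_subset fU'].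
Qed.

Lemma smooth_at_add (f g : V -> W) x :
  smooth_at f x -> smooth_at g x -> smooth_at (fun z => f z + g z) x.
Proof.
move=> /smooth_atP[U [oU Ux aU]] /smooth_atP[U' [oU' Ux' fU']].
apply/smooth_atP; exists (U `&` U'); split => //; first exact: openI.
by apply: smooth_in_add; [exact: openI|exact: smooth_in_subset aU|
  exact: smooth_in_subset fU'].
Qed.

Lemma smooth_at_cst (w : W) x : smooth_at (fun _ : V => w) x.
Proof.
apply/smooth_atP; exists setT; split => //; first exact: openT.
by apply: smooth_in_cst; exact: openT.
Qed.

Lemma smooth_at_continuous (f : V -> W) x : smooth_at f x -> {for x, continuous f}.
Proof. by move=> /smooth_atP[U [oU Ux fU]]; exact: smooth_in_continuous fU Ux. Qed.

Lemma smooth_at_is_derive (f : V -> W) x v : smooth_at f x -> is_derive x v f ('D_v f x).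
Proof. by move=> /smooth_atP[U [oU Ux fU]]; exact: smooth_in_is_derive fU Ux. Qed.

End SmoothGerms.

Lemma smooth_at_linear_comp (R : realType) (V W W' : normedModType R) (l : W -> W')
    (f : V -> W) x : linear l -> continuous l -> smooth_at f x -> smooth_at (l \o f) x.
Proof.
move=> ll cl /smooth_atP[U [oU Ux fU]]; apply/smooth_atP; exists U; split => //.
exact: smooth_in_comp_linear.
Qed.

Section Euclidean.
Context (R : realType) (V : finNormedModType R) (dot : {dot V for idfun}).
Hypothesis normE : forall x : V, `|x| ^+ 2 = dot x x.

Lemma dotC x y : dot x y = dot y x.
Proof. by rewrite hermC expr0 mul1r. Qed.

Lemma dotDl x y z : dot (x + y) z = dot x z + dot y z.
Proof. exact: linearDl. Qed.

Lemma dotZl a x z : dot (a *: x) z = a * dot x z.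
Proof. by rewrite linearZl_LR. Qed.

Lemma dotDr x y z : dot z (x + y) = dot z x + dot z y.
Proof. by rewrite dotC dotDl !(dotC z). Qed.

Lemma dotZr a x z : dot z (a *: x) = a * dot z x.
Proof. by rewrite dotC dotZl (dotC z). Qed.

Lemma dot_sumr n (f : 'I_n -> V) z : dot z (\sum_i f i) = \sum_i dot z (f i).
Proof.
elim: n f => [|n IH] f; last by rewrite !big_ord_recl dotDr IH.
by rewrite !big_ord0 -(scale0r (0 : V)) dotZr mul0r.
Qed.

Lemma dot_suml n (f : 'I_n -> V) z : dot (\sum_i f i) z = \sum_i dot (f i) z.
Proof. by rewrite dotC dot_sumr; apply: eq_bigr => i _; rewrite dotC. Qed.

Lemma dot_gt0 x : x != 0 -> 0 < dot x x.
Proof. by move=> x0; rewrite -normE exprn_gt0// normr_gt0. Qed.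

Lemma dot_linear v : linear (fun x => dot x v : R^o).
Proof. by move=> a x y; rewrite dotDl dotZl. Qed.

(* By polarization, the inner product is continuous because the norm is. *)
Lemma dot_continuous v : continuous (fun x => dot x v : R^o).
Proof.
have E x : dot x v = (`|x + v| * `|x + v| - `|x| * `|x| - `|v| * `|v|) / 2.
  rewrite -!expr2 !normE dotDl !dotDr (dotC v x).
  by rewrite (_ : _ - _ - _ = dot x v * 2); [rewrite mulfK|ring].
rewrite (funext E) => x; apply: cvgM; last exact: cvg_cst.
apply: cvgB; last exact: cvg_cst.
have sq (f : V -> V) : {for x, continuous f} ->
    {for x, continuous (fun y => `|f y| * `|f y|)}.
  by move=> cf; apply: cvgM; exact: cvg_norm.
apply: cvgB; apply: sq; last exact: cvg_id.
by apply: cvgD; [exact: cvg_id|exact: cvg_cst].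
Qed.

Context (n : nat) (e : 'I_n -> V).
Hypothesis eE : forall x, x = \sum_i dot x (e i) *: e i.

Section LinearMaps.
Context (W : normedModType R) (l : V -> W).
Hypothesis ll : linear l.

Lemma linear_basisE x : l x = \sum_i dot x (e i) *: l (e i).
Proof.
by rewrite {1}(eE x) (linear_fun_sum ll).
Qed.

Lemma fin_linear_continuous : continuous l.
Proof.
rewrite (funext linear_basisE) => x; apply: continuous_sum => i.
by apply: cvgZr_tmp; exact: dot_continuous.
Qed.

End LinearMaps.

Lemma riesz (l : V -> R^o) : linear l -> exists v, forall x, l x = dot x v.
Proof.
move=> ll; exists (\sum_i l (e i) *: e i) => x.
rewrite dot_sumr (linear_basisE ll); apply: eq_bigr => i _.
by rewrite dotZr -[LHS]/(_ * _) mulrC.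
Qed.

Section HomogeneousPolynomials.
Context (W : normedModType R).

(* An inductive form of [homog_poly] (see [homog_polyP]), in which the linear
   forms are those represented by the inner product. *)
Inductive hpoly : nat -> (V -> W) -> Prop :=
| hpoly_zero l : hpoly l (fun=> 0)
| hpoly_cst w : hpoly 0 (fun=> w)
| hpoly_add l p q of hpoly l p & hpoly l q : hpoly l (fun x => p x + q x)
| hpoly_dot l v p of hpoly l p : hpoly l.+1 (fun x => dot x v *: p x).

Lemma eq_hpoly l p q : p =1 q -> hpoly l p -> hpoly l q.
Proof. by move=> /funext ->. Qed.

Lemma hpoly_sum l m (p : 'I_m -> V -> W) :
  (forall i, hpoly l (p i)) -> hpoly l (fun x => \sum_i p i x).
Proof.
elim: m p => [|m IH] p hp.
  by apply: eq_hpoly (hpoly_zero l) => x; rewrite big_ord0.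
apply: (@eq_hpoly _ (fun x => p ord0 x + \sum_i p (lift ord0 i) x)).
  by move=> x; rewrite big_ord_recl.
by apply: hpoly_add => //; exact: IH.
Qed.

Lemma hpolyZ l a p : hpoly l p -> hpoly l (fun x => a *: p x).
Proof.
elim=> {l p} [l|w|l p q _ IHp _ IHq|l v p _ IH].
- by apply: eq_hpoly (hpoly_zero l) => x; rewrite scaler0.
- exact: hpoly_cst.
- by apply: eq_hpoly (hpoly_add IHp IHq) => x; rewrite scalerDr.
- by apply: eq_hpoly (hpoly_dot v IH) => x; rewrite !scalerA mulrC.
Qed.

Lemma hpolyN l p : hpoly l p -> hpoly l (fun x => - p x).
Proof. by move/(hpolyZ (-1)); apply: eq_hpoly => x; rewrite scaleN1r. Qed.

Lemma hpolyE l p s x : hpoly l p -> p (s *: x) = s ^+ l *: p x.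
Proof.
elim=> {l p} [l|w|l p q _ IHp _ IHq|l v p _ IH].
- by rewrite scaler0.
- by rewrite expr0 scale1r.
- by rewrite IHp IHq scalerDr.
- by rewrite dotZl IH !scalerA exprS; congr (_ *: _); ring.
Qed.

Lemma hpoly_smooth l p U : open U -> hpoly l p -> smooth_in U p.
Proof.
move=> oU; elim=> {l p} [l|w|l p q _ IHp _ IHq|l v p _ IH].
- exact: smooth_in_cst.
- exact: smooth_in_cst.
- exact: smooth_in_add.
- apply: smooth_in_scale => //.
  by apply: smooth_in_linear => //; [exact: dot_linear|exact: dot_continuous].
Qed.

Lemma hpoly_smooth_at l p x : hpoly l p -> smooth_at p x.
Proof.
move=> hp; apply/smooth_atP; exists setT; split => //; first exact: openT.
by apply: hpoly_smooth hp; exact: openT.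
Qed.

Lemma dot_differentiable v x : differentiable (fun y => dot y v : R^o) x.
Proof.
pose L : {linear V -> R^o} :=
  HB.pack (fun y => dot y v : R^o) (GRing.isLinear.Build _ _ _ _ _ (dot_linear v)).
by apply: (@linear_differentiable _ _ _ L); exact: dot_continuous.
Qed.

Lemma hpoly_differentiable l p x : hpoly l p -> differentiable p x.
Proof.
(* The factor [a] accumulates the linear forms met in the induction, which thus ends on a scalar
   function times a constant vector. *)
move=> hp; suff : forall a : V -> R, differentiable a x ->
    differentiable (fun y => a y *: p y) x.
  move=> H; have -> : p = fun y => 1 *: p y.
    by apply/funext => y; rewrite scale1r.
  by apply: H; exact: differentiable_cst.
elim: hp => {l p} [l|w|l p q _ IHp _ IHq|l v p _ IH] a da.
- by under eq_fun do rewrite scaler0; exact: differentiable_cst.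
- exact: differentiableZl.
- under eq_fun do rewrite scalerDr.
  by apply: differentiableD; [exact: IHp|exact: IHq].
- under eq_fun do rewrite scalerA.
  apply: (IH (fun y => a y * dot y v)); apply: differentiableM => //.
  exact: dot_differentiable.
Qed.

Lemma derive_dot v u x : is_derive x u (fun y => dot y v : R^o) (dot u v).
Proof.
apply: (@is_derive_linear _ _ _ _ (fun y => dot y v : R^o) id x u u) => //.
- exact: dot_linear.
- exact: dot_continuous.
Qed.

Lemma hpoly_is_derive l p x u : hpoly l p -> is_derive x u p ('D_u p x).
Proof. by move=> hp; apply: smooth_at_is_derive; exact: hpoly_smooth_at hp. Qed.

Lemma hpoly_deriveM l p x u v : hpoly l p ->
  'D_u (fun y => dot y v *: p y) x = dot u v *: p x + dot x v *: 'D_u p x.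
Proof.
move=> hp; have [_ //] : is_derive x u (fun y => dot y v *: p y)
  (dot u v *: p x + dot x v *: 'D_u p x).
apply: is_derive_scale; last exact: hpoly_is_derive hp.
- by apply: smooth_at_continuous; exact: hpoly_smooth_at hp.
- exact: derive_dot.
Qed.

Lemma hpoly_deriveD l p q x u : hpoly l p -> hpoly l q ->
  'D_u (fun y => p y + q y) x = 'D_u p x + 'D_u q x.
Proof.
move=> hp hq; have [dp _] := hpoly_is_derive x u hp.
by have [dq _] := hpoly_is_derive x u hq; rewrite -deriveD.
Qed.

(** For l = 0 the degree [l.-1] is again 0. The second clause records that the derivative then
    vanishes, which the product rule needs when a linear form multiplies a constant. *)
Lemma hpoly_derive l p u : hpoly l p ->
  hpoly l.-1 ('D_u p) /\ (l = 0%N -> forall x, 'D_u p x = 0).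
Proof.
elim=> {l p} [l|w|l p q hp [IHp IHp0] hq [IHq IHq0]|l v p hp [IH IH0]].
- split => [|_ x]; last exact: derive_cst.
  by apply: eq_hpoly (hpoly_zero _) => x; rewrite derive_cst.
- split => [|_ x]; last exact: derive_cst.
  by apply: eq_hpoly (hpoly_zero _) => x; rewrite derive_cst.
- split => [|l0 x]; last by rewrite (hpoly_deriveD _ _ hp hq) IHp0// IHq0// addr0.
  apply: eq_hpoly (hpoly_add IHp IHq) => x.
  by rewrite (hpoly_deriveD _ _ hp hq).
- split => //=; apply: (@eq_hpoly _ (fun x => dot u v *: p x + dot x v *: 'D_u p x)).
    by move=> x; rewrite (hpoly_deriveM _ _ _ hp).
  apply: hpoly_add; first exact: hpolyZ.
  case: l hp IH IH0 => [|l] hp IH IH0; last exact: hpoly_dot.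
  by apply: eq_hpoly (hpoly_zero _) => x; rewrite IH0// scaler0.
Qed.

Lemma euler l p x : hpoly l p -> 'D_x p x = l%:R *: p x.
Proof.
elim=> {l p} [l|w|l p q hp IHp hq IHq|l v p hp IH].
- by rewrite derive_cst scaler0.
- by rewrite derive_cst scale0r.
- by rewrite (hpoly_deriveD _ _ hp hq) IHp IHq scalerDr.
- rewrite (hpoly_deriveM _ _ _ hp) IH !scalerA -scalerDl; congr (_ *: _).
  by rewrite -natr1; ring.
Qed.

End HomogeneousPolynomials.

Lemma hpoly_comp_linear (W W' : normedModType R) l (p : V -> W) (f : W -> W') :
  linear f -> hpoly l p -> hpoly l (f \o p).
Proof.
move=> lf; elim=> {l p} [l|w|l p q _ IHp _ IHq|l v p _ IH].
- by apply: eq_hpoly (hpoly_zero _ l) => x /=; rewrite (linear_fun0 lf).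
- exact: (hpoly_cst (f w)).
- by apply: eq_hpoly (hpoly_add IHp IHq) => x /=; rewrite (linear_funD lf).
- by apply: eq_hpoly (hpoly_dot v IH) => x /=; rewrite (linear_funZ lf).
Qed.

Lemma hpoly_linear_comp (W : normedModType R) l (p : V -> W) (A : V -> V) :
  linear A -> hpoly l p -> hpoly l (p \o A).
Proof.
move=> lA; elim=> {l p} [l|w|l p q _ IHp _ IHq|l v p _ IH].
- exact: hpoly_zero.
- exact: hpoly_cst.
- exact: hpoly_add.
- have [u uE] : exists u, forall x, dot (A x) v = dot x u.
    by apply: riesz => a x y; rewrite lA; exact: dot_linear.
  by apply: eq_hpoly (hpoly_dot u IH) => x /=; rewrite -uE.
Qed.

Lemma hpoly_scale (W : normedModType R) m l (a : V -> R) (p : V -> W) :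
  hpoly m (a : V -> R^o) -> hpoly l p -> hpoly (m + l) (fun x => a x *: p x).
Proof.
move=> ha hp; elim: ha => {m a} [m|w|m a b _ IHa _ IHb|m v a _ IH].
- by apply: eq_hpoly (hpoly_zero _ _) => x; rewrite scale0r.
- exact: hpolyZ.
- by apply: eq_hpoly (hpoly_add IHa IHb) => x; rewrite scalerDl.
- by rewrite addSn; apply: eq_hpoly (hpoly_dot v IH) => x; rewrite scalerA.
Qed.

(** The degree is (l - 1) + (m + 1), written without truncated subtraction; for l = 0 the derivative
    is zero, hence homogeneous of every degree. *)
Lemma hpoly_derive_field (W : normedModType R) l m (p : V -> W) (Y : V -> V) :
  hpoly l p -> hpoly m.+1 Y -> hpoly (l + m) (fun x => 'D_(Y x) p x).
Proof.
move=> hp hY; elim: hp => {l p} [l|w|l p q hp IHp hq IHq|l v p hp IH].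
- by apply: eq_hpoly (hpoly_zero _ _) => x; rewrite derive_cst.
- by apply: eq_hpoly (hpoly_zero _ _) => x; rewrite derive_cst.
- apply: eq_hpoly (hpoly_add IHp IHq) => x.
  by rewrite (hpoly_deriveD _ _ hp hq).
- have hYv : hpoly m.+1 ((fun x => dot (Y x) v) : V -> R^o).
    exact: (hpoly_comp_linear (dot_linear v) hY).
  apply: (@eq_hpoly _ _ (fun x => dot (Y x) v *: p x + dot x v *: 'D_(Y x) p x)).
    by move=> x; rewrite (hpoly_deriveM _ _ _ hp).
  apply: hpoly_add; last by rewrite addSn; exact: hpoly_dot.
  by rewrite addSn -addnS addnC; exact: hpoly_scale.
Qed.

Lemma homog_polyP l (p : V -> V) : homog_poly l p <-> hpoly l p.
Proof.
have prod k (c : 'I_k -> {scalar V}) (w : V) : hpoly k (fun x => (\prod_j c j x) *: w).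
  elim: k c => [|k IH] c.
    by apply: eq_hpoly (hpoly_cst w) => x; rewrite big_ord0 scale1r.
  have [u uE] : exists u, forall x, c ord0 x = dot x u.
    by apply: riesz => a x y; rewrite linearP.
  apply: eq_hpoly (hpoly_dot u (IH (fun j => c (lift ord0 j)))) => x /=.
  by rewrite big_ord_recl scalerA uE.
split => [[m [c [v pE]]]|].
  apply: (@eq_hpoly _ _ (fun x => \sum_i (\prod_j c i j x) *: v i)) => //.
  exact: hpoly_sum.
elim=> {l p} [l|w|l p q _ [m [c [v pE]]] _ [m' [c' [v' qE]]]|l u p _ [m [c [v pE]]]].
- by exists 0%N, (fun i : 'I_0 => False_rect _ (notF (ltn_ord i))),
    (fun=> 0) => x; rewrite big_ord0.
- exists 1%N, (fun _ (j : 'I_0) => False_rect _ (notF (ltn_ord j))), (fun=> w) => x.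
  by rewrite big_ord1 big_ord0 scale1r.
- exists (m + m')%N, (fun i => match fintype.split i with inl i => c i | inr i => c' i end),
    (fun i => match fintype.split i with inl i => v i | inr i => v' i end) => x.
  rewrite pE qE big_split_ord /=; congr (_ + _); apply: eq_bigr => i _.
    by rewrite (unsplitK (inl i)).
  by rewrite (unsplitK (inr i)).
- pose cu : {scalar V} := HB.pack (fun y => dot y u : R^o)
    (GRing.isLinear.Build _ _ _ _ _ (dot_linear u)).
  exists m, (fun i j => if unlift ord0 j is Some j' then c i j' else cu), v => x.
  rewrite pE scaler_sumr; apply: eq_bigr => i _; rewrite scalerA; congr (_ *: _).
  rewrite big_ord_recl unlift_none; congr (_ * _); apply: eq_bigr => j _.
  by rewrite liftK.
Qed.

End Euclidean.

(** * Powers of the maximal ideal *)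

Lemma cvg_sum (R : realType) (T : Type) (F : set_system T) (FF : Filter F)
    (W : normedModType R) m (f : 'I_m -> T -> W) (l : 'I_m -> W) :
  (forall i, f i x @[x --> F] --> l i) -> \sum_i f i x @[x --> F] --> \sum_i l i.
Proof.
elim: m f l => [|m IH] f l fl.
  by under eq_fun do rewrite big_ord0; rewrite big_ord0; exact: cvg_cst.
under eq_fun do rewrite big_ord_recl; rewrite big_ord_recl.
by apply: cvgD; [exact: fl|apply: IH => i; exact: fl].
Qed.

Lemma cvg_prod (R : realType) (T : Type) (F : set_system T) (FF : Filter F)
    m (f : 'I_m -> T -> R) (l : 'I_m -> R) :
  (forall i, f i x @[x --> F] --> l i) -> \prod_i f i x @[x --> F] --> \prod_i l i.
Proof.
elim: m f l => [|m IH] f l fl.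
  by under eq_fun do rewrite big_ord0; rewrite big_ord0; exact: cvg_cst.
under eq_fun do rewrite big_ord_recl; rewrite big_ord_recl.
by apply: cvgM; [exact: fl|apply: IH => i; exact: fl].
Qed.

Lemma eq_cvg_dnbhs0 (R : realType) (W : normedModType R) (f g : R -> W) (l : W) :
  (forall s, s != 0 -> f s = g s) ->
  f s @[s --> (0 : R)^'] --> l -> g s @[s --> (0 : R)^'] --> l.
Proof.
move=> fg fl; apply: cvg_trans fl; apply: near_eq_cvg.
by apply: (@near_dnbhs0 R setT) => [s s0 _|]; [exact: fg|exact: filterT].
Qed.

Lemma cvg_dnbhs0_id (R : realType) : s @[s --> (0 : R)^'] --> (0 : R).
Proof. by apply: cvg_within_filter; exact: cvg_id. Qed.

Section IdealPowers.
Context (R : realType) (V : finNormedModType R) (dot : {dot V for idfun}).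
Hypothesis normE : forall x : V, `|x| ^+ 2 = dot x x.
Context (n : nat) (e : 'I_n -> V).
Hypothesis eE : forall x, x = \sum_i dot x (e i) *: e i.
Notation M := (@maximal_ideal R V).
Implicit Types (f g : V -> V) (a : V -> R).

Lemma eq_MjE j f g : (\forall x \near 0, f x = g x) -> MjE j f -> MjE j g.
Proof.
move=> fg [m [a [k [aM ks fE]]]]; exists m, a, k; split => //.
by apply: filterS2 fg fE => x <-.
Qed.

Lemma MjE_smooth f : smooth_at f 0 -> MjE 0 f.
Proof.
move=> sf; exists 1%N, (fun _ (j : 'I_0) => False_rect _ (notF (ltn_ord j))), (fun=> f).
by split => [i []||] //; near=> x; rewrite big_ord1 big_ord0 scale1r.
Unshelve. all: end_near. Qed.

Lemma MjE_zero j : MjE j (fun _ : V => 0 : V).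
Proof.
exists 0%N, (fun i : 'I_0 => False_rect _ (notF (ltn_ord i))), (fun=> fun=> 0).
by split => [[]|[]|] //; near=> x; rewrite big_ord0.
Unshelve. all: end_near. Qed.

Lemma MjE_add j f g : MjE j f -> MjE j g -> MjE j (fun x => f x + g x).
Proof.
move=> [m [a [k [aM ks fE]]]] [m' [a' [k' [aM' ks' gE]]]].
exists (m + m')%N, (fun i => match fintype.split i with inl i => a i | inr i => a' i end),
  (fun i => match fintype.split i with inl i => k i | inr i => k' i end).
split => [i l|i|]; [by case: fintype.split|by case: fintype.split|].
apply: filterS2 fE gE => x -> ->; rewrite big_split_ord /=.
congr (_ + _); apply: eq_bigr => i _.
  by rewrite (unsplitK (inl i)).
by rewrite (unsplitK (inr i)).
Qed.

Lemma MjE_sum j m (f : 'I_m -> V -> V) :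
  (forall i, MjE j (f i)) -> MjE j (fun x => \sum_i f i x).
Proof.
elim: m f => [|m IH] f fM.
  by apply: eq_MjE (MjE_zero j); near=> x; rewrite big_ord0.
apply: (@eq_MjE _ (fun x => f ord0 x + \sum_i f (lift ord0 i) x)).
  by near=> x; rewrite big_ord_recl.
by apply: MjE_add => //; exact: IH.
Unshelve. all: end_near. Qed.

Lemma MjE_mul j a f : M a -> MjE j f -> MjE j.+1 (fun x => a x *: f x).
Proof.
move=> Ma [m [b [k [bM ks fE]]]].
exists m, (fun i l => if unlift ord0 l is Some l' then b i l' else a), k.
split => [i l|//|]; first by case: unlift.
apply: filterS fE => x ->; rewrite scaler_sumr; apply: eq_bigr => i _.
rewrite scalerA big_ord_recl unlift_none; congr (_ * _ *: _).
by apply: eq_bigr => l _; rewrite liftK.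
Qed.

Lemma MjE_weaken j f : MjE j.+1 f -> MjE j f.
Proof.
move=> [m [a [k [aM ks fE]]]].
exists m, (fun i l => a i (lift ord0 l)), (fun i x => a i ord0 x *: k i x).
split => // [i|]; first by apply: smooth_at_scale => //; have [] := aM i ord0.
apply: filterS fE => x ->; apply: eq_bigr => i _.
by rewrite big_ord_recl scalerA mulrC.
Qed.

Lemma MjE_le j l f : (j <= l)%N -> MjE l f -> MjE j f.
Proof.
move=> /subnK <-; elim: (l - j)%N => [//|d IH] fM.
by apply: IH; apply: MjE_weaken; rewrite -addSn.
Qed.

Lemma maximal_ideal_dot v : M (fun x => dot x v).
Proof.
split; last by rewrite -(scale0r (0 : V)) dotZl mul0r.
apply/smooth_atP; exists setT; split => //; first exact: openT.
apply: smooth_in_linear; first exact: openT.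
- exact: dot_linear.
- exact: dot_continuous.
Qed.

Lemma hpoly_MjE l (p : V -> V) : hpoly dot l p -> MjE l p.
Proof.
elim=> {l p} [l|w|l p q _ IHp _ IHq|l v p _ IH].
- exact: MjE_zero.
- by apply: MjE_smooth; exact: smooth_at_cst.
- exact: MjE_add.
- by apply: MjE_mul => //; exact: maximal_ideal_dot.
Qed.

Lemma maximal_ideal_hadamard a : M a -> exists b : 'I_n -> V -> R,
  (forall i, smooth_at (b i) 0) /\
  \forall x \near 0, a x = \sum_i dot x (e i) * b i x.
Proof.
move=> [/smooth_atP[U [oU U0 aU]] a0].
(* A ball about 0 is star-shaped, as [hadamard] requires; [U] itself may not be. *)
have /nbhs_ballP[r /= r0 rU] := open_nbhs_nbhs (conj oU U0).
have oB : open (ball (0 : V) r) by exact: ball_open.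
have starB x (t : R) : ball (0 : V) r x -> t \in `[0, 1] -> ball (0 : V) r (t *: x).
  rewrite -ball_normE /= !sub0r !normrN in_itv/= => xr /andP[t0 t1].
  by apply: le_lt_trans xr; rewrite normrZ ger0_norm// ler_piMl.
have [b [bs bE]] := hadamard oB starB eE (smooth_in_subset rU aU) a0.
exists b; split => [i|].
  by apply/smooth_atP; exists (ball 0 r); split => //; exact: ballxx.
have := near_open oB (ballxx (0 : V) r0).
by apply: filterS => x xB; exact: bE.
Qed.

Lemma maximal_ideal_sub_cst a : smooth_at a 0 -> M (fun x => a x - a 0).
Proof.
move=> sa; split; last by rewrite subrr.
by apply: (smooth_at_add sa); exact: smooth_at_cst.
Qed.

(** Hadamard writes the first factor as a sum of x_i b_i, and its contribution to the leading term
    is the sum of x_i b_i(0). With p the leading term of the other factors, the error is the first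
    factor times their remainder, plus the sum of x_i (b_i - b_i(0)) p; both gain the required
    order. *)
Lemma MjE_leading_term j (a : 'I_j -> V -> R) g :
  (forall l, M (a l)) -> smooth_at g 0 ->
  exists p, hpoly dot j p /\ MjE j.+1 (fun x => (\prod_l a l x) *: g x - p x).
Proof.
move=> + sg; elim: j a => [|j IH] a aM.
  exists (fun=> g 0); split; first exact: hpoly_cst.
  apply: (@eq_MjE _ (fun x => \sum_i (dot (g x) (e i) - dot (g 0) (e i)) *: e i)).
    near=> x; rewrite big_ord0 scale1r; under eq_bigr do rewrite scalerBl.
    by rewrite sumrB -!eE.
  apply: MjE_sum => i; apply: MjE_mul; last by apply: MjE_smooth; exact: smooth_at_cst.
  apply: (@maximal_ideal_sub_cst (fun x => dot (g x) (e i))).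
  by apply: (@smooth_at_linear_comp _ _ _ R^o (fun y => dot y (e i))) => //;
    [exact: dot_linear|exact: dot_continuous].
have [p [hp rM]] := IH (fun l => a (lift ord0 l)) (fun l => aM _).
have [b [bs bE]] := maximal_ideal_hadamard (aM ord0).
exists (fun x => \sum_i dot x (e i) *: (b i 0 *: p x)); split.
  by apply: hpoly_sum => i; apply: hpoly_dot; exact: hpolyZ.
apply: eq_MjE (MjE_add (MjE_mul (aM ord0) rM)
  (MjE_sum (fun i => MjE_mul (maximal_ideal_dot (e i))
    (MjE_mul (maximal_ideal_sub_cst (bs i)) (hpoly_MjE hp))))).
apply: filterS bE => x aE; rewrite big_ord_recl.
set P := \prod_i _; rewrite scalerBr -scalerA -addrA; congr (_ + _).
under eq_bigr do rewrite scalerBl scalerBr.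
rewrite sumrB addrA.
rewrite [X in - _ + X](_ : _ = a ord0 x *: p x) ?addNr ?add0r//.
by rewrite aE scaler_suml; apply: eq_bigr => i _; rewrite scalerA.
Unshelve. all: end_near. Qed.

Lemma MjE_leading j f : MjE j f ->
  exists p, hpoly dot j p /\ MjE j.+1 (fun x => f x - p x).
Proof.
move=> [m [a [g [aM gs fE]]]].
have /choice[p pP] i : exists p, hpoly dot j p /\
    MjE j.+1 (fun x => (\prod_l a i l x) *: g i x - p x).
  exact: MjE_leading_term.
exists (fun x => \sum_i p i x); split; first by apply: hpoly_sum => i; have [] := pP i.
apply: (@eq_MjE _ (fun x => \sum_i ((\prod_l a i l x) *: g i x - p i x))).
  by apply: filterS fE => x ->; rewrite sumrB.
by apply: MjE_sum => i; have [] := pP i.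
Qed.

(* Vanishing to order [> j] along each line: weaker than membership in M^(j+1) E,
   but stable under linear substitutions and still sufficient to determine
   Taylor polynomials. *)
Definition small j f := forall x, s ^- j *: f (s *: x) @[s --> (0 : R)^'] --> (0 : V).

Lemma near_scale (A : set V) x : nbhs 0 A -> \forall s \near (0 : R)^', A (s *: x).
Proof.
move=> A0; have : s *: x @[s --> (0 : R)^'] --> (0 : V).
  rewrite -[X in _ --> X](scale0r x).
  by apply: cvgZr_tmp; apply: cvg_within_filter; exact: cvg_id.
by apply.
Qed.

(** Each of the j factors takes one power of 1/s and tends to its derivative at 0 along [x]. *)
Lemma MjE_cvg j f x : MjE j f ->
  exists L, s ^- j *: f (s *: x) @[s --> (0 : R)^'] --> (L : V).
Proof.
move=> [m [a [g [aM gs fE]]]].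
exists (\sum_i (\prod_l 'D_x (a i l) 0) *: g i 0).
have limg i : g i (s *: x) @[s --> (0 : R)^'] --> g i 0.
  have := cvg_line x (smooth_at_continuous (gs i)).
  by under eq_fun do rewrite addr0.
have lima i l : s^-1 * a i l (s *: x) @[s --> (0 : R)^'] --> 'D_x (a i l) 0.
  have [sa a0] := aM i l; have := is_derive_cvg (smooth_at_is_derive x sa).
  by under eq_fun do rewrite addr0 a0 subr0.
apply: (@cvg_trans _ (\sum_i (\prod_l (s^-1 * a i l (s *: x))) *: g i (s *: x)
    @[s --> (0 : R)^'])).
  apply: near_eq_cvg; apply: filterS (near_scale x fE) => s ->.
  rewrite scaler_sumr; apply: eq_bigr => i _.
  by rewrite big_split /= prodr_const card_ord exprVn scalerA.
apply: cvg_sum => i; apply: cvgZ; last exact: limg.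
exact: cvg_prod.
Qed.

Lemma scale_expr_cvg0 j f x (L : V) : s ^- j.+1 *: f (s *: x) @[s --> (0 : R)^'] --> L ->
  s ^- j *: f (s *: x) @[s --> (0 : R)^'] --> (0 : V).
Proof.
move=> fL.
apply: (@eq_cvg_dnbhs0 _ _ (fun s : R => s *: (s ^- j.+1 *: f (s *: x)))) => [s s_neq0|].
  by rewrite scalerA exprS invfM mulrA mulfV// mul1r.
by rewrite -(scale0r L); apply: cvgZ => //; exact: cvg_dnbhs0_id.
Qed.

Lemma MjE_small j f : MjE j.+1 f -> small j f.
Proof. by move=> fM x; have [L fL] := MjE_cvg x fM; exact: scale_expr_cvg0 fL. Qed.

Lemma eq_small j f g : (\forall x \near 0, f x = g x) -> small j f -> small j g.
Proof.
move=> fg fs x; apply: cvg_trans (fs x); apply: near_eq_cvg.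
by apply: filterS (near_scale x fg) => s ->.
Qed.

Lemma small_add j f g : small j f -> small j g -> small j (fun x => f x + g x).
Proof.
move=> fs gs x.
apply: (@eq_cvg_dnbhs0 _ _ (fun s : R => s ^- j *: f (s *: x) + s ^- j *: g (s *: x))).
  by move=> s _; rewrite scalerDr.
by rewrite -(addr0 (0 : V)); apply: cvgD; [exact: fs|exact: gs].
Qed.

Lemma small_linear_comp j f (A : V -> V) : linear A -> small j f ->
  small j (fun x => f (A x)).
Proof.
by move=> lA fs x; under eq_fun do rewrite (linear_funZ lA); exact: fs.
Qed.

Lemma small_comp_linear j f (A : V -> V) : linear A -> small j f ->
  small j (fun x => A (f x)).
Proof.
move=> lA fs x.
have cA : {for 0, continuous A} by exact: (fin_linear_continuous normE eE lA).
under eq_fun do rewrite -(linear_funZ lA).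
by rewrite -(linear_fun0 lA); exact: (cvg_comp _ _ (fs x) cA).
Qed.

(** By homogeneity s^-j p(s x) is constantly p(x), and its limit is 0. *)
Lemma hpoly_small_eq0 j p x : hpoly dot j p -> small j p -> p x = 0.
Proof.
move=> hp /(_ x) ps; apply: (cvg_unique _ _ ps) => //.
rewrite /=; apply: (@eq_cvg_dnbhs0 _ _ (fun=> p x)) => [s s_neq0|]; last exact: cvg_cst.
by rewrite (hpolyE _ _ hp) scalerA mulVf ?scale1r// expf_neq0.
Qed.

(** The top term is small to every order below its degree, so subtracting it preserves the
    hypothesis for the lower terms. These vanish by induction, and the top term, now equal to the
    whole sum, is small to its own degree. *)
Lemma poly_small_eq0 k (p : nat -> V -> V) x : (forall l, hpoly dot l (p l)) ->
  (forall j, (j < k)%N -> small j (fun x => \sum_(0 <= l < k) p l x)) ->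
  \sum_(0 <= l < k) p l x = 0.
Proof.
move=> hp; elim: k x => [|k IH] x ps; first by rewrite big_geq.
have pk0 j : (j < k)%N -> small j (p k).
  by move=> jk; apply: MjE_small; apply: MjE_le jk _; exact: hpoly_MjE.
have lt0 y : \sum_(0 <= l < k) p l y = 0.
  apply: IH => j jk.
  apply: (@eq_small _ (fun x => \sum_(0 <= l < k.+1) p l x + - p k x)).
    by near=> z; rewrite big_nat_recr//= addrK.
  apply: small_add; first by apply: ps; exact: ltnW.
  apply: (@small_comp_linear _ (p k) -%R); last exact: pk0.
  by move=> a u v; rewrite opprD scalerN.
rewrite big_nat_recr//= lt0 add0r; apply: (hpoly_small_eq0 x (hp k)).
apply: eq_small (ps k (leqnn _)).
by near=> z; rewrite big_nat_recr//= lt0 add0r.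
Unshelve. all: end_near. Qed.

End IdealPowers.

(** * The exponential flow *)

Lemma is_derive_comp_curve (R : realType) (V W : normedModType R) (q : V -> W)
    (y : R -> V) (s : R) (dy : V) :
  differentiable q (y s) -> is_derive s (1 : R) y dy ->
  is_derive s (1 : R) (q \o y) ('D_dy q (y s)).
Proof.
move=> dq [/derivable1_diffP ydiff yE].
have dqy : differentiable (q \o y) s by exact: differentiable_comp.
split; first exact/derivable1_diffP.
by rewrite deriveE// diff_comp//= deriveE// -yE deriveE.
Qed.

Section ExponentialFlow.
Context (R : realType) (V : finNormedModType R) (dot : {dot V for idfun}).
Hypothesis normE : forall x : V, `|x| ^+ 2 = dot x x.
Context (n : nat) (e : 'I_n -> V).
Hypothesis eE : forall x, x = \sum_i dot x (e i) *: e i.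

Lemma fin_linear_bounded (W : normedModType R) (f : V -> W) : linear f ->
  exists2 K : R, 0 < K & forall x, `|f x| <= K * `|x|.
Proof.
move=> lf; pose F : {linear V -> W} := HB.pack f (GRing.isLinear.Build _ _ _ _ f lf).
by apply: (@linear_lipschitz _ _ _ F); exact: (fin_linear_continuous normE eE lf).
Qed.

Section Flow.
Context (B : {linear V -> V}).

(** Taylor coefficients of the scalar function s |-> dot (e^{sB} x) v. Convergence and
    differentiation of the vector exponential are obtained from these scalar power series. *)
Let c x v i : R := dot (iter i B x) v / i`!%:R.

Let is_cvg_c x v s : cvgn (pseries (c x v) s).
Proof.
have [K K0 BK] := fin_linear_bounded (linearP B).
have [D D0 vD] := fin_linear_bounded (dot_linear dot v).
have iterK i : `|iter i B x| <= K ^+ i * `|x|.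
  elim: i => [|i IH]; first by rewrite expr0 mul1r.
  apply: le_trans (BK _) _; rewrite exprS -mulrA.
  by rewrite ler_wpM2l// ltW.
apply: normed_cvg.
(* With [K] a bound for [B] and [D] a bound for pairing with [v], the terms are dominated by those
   of the exponential series at K|s|. *)
apply: (@series_le_cvg _ _ (fun i => D * `|x| * exp_coeff (K * `|s|) i)) => [i|i|i|].
- exact: normr_ge0.
- by rewrite mulr_ge0 ?exp_coeff_ge0 ?mulr_ge0// ltW.
- rewrite /exp_coeff /= /c !normrM normfV normrX exprMn.
  rewrite (ger0_norm (ler0n _ _)) mulrAC [leRHS]mulrA ler_wpM2r ?invr_ge0 ?ler0n//.
  rewrite mulrA ler_wpM2r ?exprn_ge0//.
  apply: le_trans (vD _) _; rewrite -mulrA ler_wpM2l ?(ltW D0)//.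
  by rewrite mulrC; exact: iterK.
- by apply: is_cvg_seriesZ; exact: is_cvg_series_exp_coeff.
Qed.

Lemma exp_lin_cvg s x : series (fun i => (s ^+ i / i`!%:R) *: iter i B x) @ \oo -->
  \sum_i limn (pseries (c x (e i)) s) *: e i.
Proof.
rewrite [X in X @ _ --> _](_ : _ = fun m => \sum_i pseries (c x (e i)) s m *: e i).
  apply: cvg_sum => i; apply: cvgZr_tmp; exact: is_cvg_c.
apply/funext => m; rewrite /pseries /series /=.
under [RHS]eq_bigr do rewrite scaler_suml.
rewrite exchange_big; apply: eq_bigr => j _ /=.
rewrite {1}(eE (iter j B x)) scaler_sumr; apply: eq_bigr => i _.
by rewrite scalerA /c; congr (_ *: _); ring.
Qed.

Lemma dot_exp_lin s x v : dot (exp_lin s B x) v = limn (pseries (c x v) s).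
Proof.
have cv := exp_lin_cvg (s := s) (x := x).
have -> : exp_lin s B x = \sum_i limn (pseries (c x (e i)) s) *: e i.
  by apply: cvg_lim cv.
have H := cvg_comp _ _ cv (@dot_continuous _ _ dot normE v _).
apply/esym/cvg_lim => //; apply: cvg_trans H; apply: near_eq_cvg.
near=> m; rewrite /= /pseries /series /= !big_mkord dot_suml.
by apply: eq_bigr => i _; rewrite dotZl /c; ring.
Unshelve. all: end_near. Qed.

Lemma exp_lin0 x : exp_lin 0 B x = x.
Proof.
apply: cvg_lim => //; rewrite -cvg_shiftS; apply: cvg_near_cst; near=> m.
rewrite /= /series /= big_nat_recl//= big1 ?addr0.
  by rewrite expr0 fact0 divr1 scale1r.
by move=> i _; rewrite expr0n/= mul0r scale0r.
Unshelve. all: end_near. Qed.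

Lemma is_derive_dot_exp_lin (s : R) x v :
  is_derive s (1 : R) (fun s => dot (exp_lin s B x) v) (dot (B (exp_lin s B x)) v).
Proof.
have [v' v'E] : exists v', forall y, dot (B y) v = dot y v'.
  by apply: (riesz eE) => a y z; rewrite linearP; exact: dot_linear.
(* Formal differentiation adds one application of [B]; moving it to the other side of the inner
   product replaces [w] by [w']. The derived series are thus of the same kind, and their convergence
   is again [is_cvg_c]. *)
have diffs w w' : (forall y, dot (B y) w = dot y w') -> pseries_diffs (c x w) = c x w'.
  move=> ww'; apply/funext => i; rewrite /pseries_diffs /c iterS ww' factS natrM invfM.
  by rewrite mulrCA [_%:R * _]mulrA mulfV ?mul1r// pnatr_eq0.
have [v2 v2E] : exists v2, forall y, dot (B y) v' = dot y v2.
  by apply: (riesz eE) => a y z; rewrite linearP; exact: dot_linear.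
under eq_fun do rewrite dot_exp_lin.
rewrite v'E dot_exp_lin -(diffs _ _ v'E).
apply: (@pseries_snd_diffs _ _ (`|s| + 1)).
- exact: is_cvg_c.
- by rewrite (diffs _ _ v'E); exact: is_cvg_c.
- by rewrite (diffs _ _ v'E) (diffs _ _ v2E); exact: is_cvg_c.
- by rewrite [X in _ < X]ger0_norm ?addr_ge0// ltrDl.
Qed.

Lemma is_derive_coord (u : R -> V) (s : R) (du : V) :
  (forall v, is_derive s (1 : R) (fun t => dot (u t) v) (dot du v)) ->
  is_derive s (1 : R) u du.
Proof.
move=> hu; apply: cvg_is_derive; rewrite (eE du).
rewrite [X in X @ _ --> _](_ : _ = fun h : R => \sum_i
  (h^-1 * (dot (u (h *: 1 + s)) (e i) - dot (u s) (e i))) *: e i); last first.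
  apply/funext => h; rewrite {1}(eE (_ *: _)); apply: eq_bigr => i _.
  by rewrite dotZl dotDl -[- u s]scaleN1r dotZl mulN1r.
by apply: cvg_sum => i; apply: cvgZr_tmp; exact: is_derive_cvg.
Qed.

Lemma is_derive_exp_lin (s : R) x :
  is_derive s (1 : R) (fun s => exp_lin s B x) (B (exp_lin s B x)).
Proof. by apply: is_derive_coord => v; exact: is_derive_dot_exp_lin. Qed.

End Flow.

Lemma is_derive_dot (u z : R -> V) (s : R) (du dz : V) :
  is_derive s (1 : R) u du -> is_derive s (1 : R) z dz ->
  is_derive s (1 : R) (fun t => dot (u t) (z t)) (dot du (z s) + dot (u s) dz).
Proof.
move=> hu hz.
have cf (f : R -> V) df : is_derive s (1 : R) f df ->
    forall v, is_derive s (1 : R) (fun t => dot (f t) v : R^o) (dot df v).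
  move=> hf v; apply: (@is_derive_linear _ _ _ _ (fun y => dot y v : R^o)) => //.
  - exact: dot_linear.
  - exact: dot_continuous.
have dotE x y : dot x y = \sum_i dot x (e i) * dot y (e i).
  rewrite {1}(eE y) dot_sumr; apply: eq_bigr => i _.
  by rewrite dotZr mulrC.
rewrite (funext (fun t => dotE (u t) (z t))) !dotE -big_split /=.
rewrite [X in is_derive _ _ X _](_ : _ =
  \sum_i (fun t => dot (u t) (e i) * dot (z t) (e i))); last first.
  by apply/funext => t; rewrite fct_sumE.
apply: is_derive_sum => i.
have Hu := cf _ _ hu (e i); have Hz := cf _ _ hz (e i).
apply: is_derive_eq; rewrite addrC; congr (_ + _); rewrite /GRing.scale /=; ring.
Qed.

Lemma exp_lin_adjoint (B B' : {linear V -> V}) s x v :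
  (forall y z, dot (B y) z = dot y (B' z)) ->
  dot (exp_lin s B x) v = dot x (exp_lin s B' v).
Proof.
move=> adj; rewrite [RHS]dotC !dot_exp_lin; congr (limn (pseries _ s)).
apply/funext => i; congr (_ / _).
elim: i x => [|i IH] x; first exact: dotC.
by rewrite iterSr IH iterS dotC adj dotC.
Qed.

(** Instead of uniqueness for differential equations: t |-> dot (q (e^{tB} x)) (e^{(s-t)B'} v) has
    derivative zero, since [B] on the left cancels [B'] on the right by adjointness. Its values at t
    = s and t = 0 are the two sides paired with [v]. *)
Lemma exp_lin_commute (B B' : {linear V -> V}) (q : V -> V) s x :
  (forall y z, dot (B y) z = dot y (B' z)) ->
  (forall y, differentiable q y) -> (forall y, 'D_(B y) q y = B (q y)) ->
  q (exp_lin s B x) = exp_lin s B (q x).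
Proof.
move=> adj dq Bq.
have adj' y z : dot (B' y) z = dot y (B z) by rewrite dotC -adj dotC.
suff E v : dot (q (exp_lin s B x)) v = dot (exp_lin s B (q x)) v.
  by rewrite (eE (q _)) [RHS]eE; apply: eq_bigr => i _; rewrite E.
pose z (t : R) := exp_lin (s + t *: ((-1) *: (1 : R^o))) B' v.
pose th t := dot (q (exp_lin t B x)) (z t).
have th0 (t : R) : is_derive t (1 : R) th 0.
  have h1 := is_derive_comp_curve (dq _) (is_derive_exp_lin B t x).
  rewrite Bq in h1.
  have h2 : is_derive t (1 : R) z (-1 *: B' (z t)).
    apply: (@is_derive_line R R^o V (fun r => exp_lin r B' v)).
    by apply: is_derive_scale_dir; exact: is_derive_exp_lin.
  have [dth thE] := is_derive_dot h1 h2; split; first exact: dth.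
  by rewrite thE /= adj dotZr mulN1r subrr.
have := is_derive_0_is_cst s 0 th0.
have -> : th s = dot (q (exp_lin s B x)) v.
  by rewrite /th /z -[s *: _]/(s * (-1 * 1)) mulr1 mulrN1 subrr exp_lin0.
rewrite /th /z exp_lin0 scale0r addr0 => ->.
by rewrite (exp_lin_adjoint _ _ _ adj).
Qed.

Lemma exp_closure_commute (B B' : {linear V -> V}) (q : V -> V) (A : 'End(V)) x :
  (forall y z, dot (B y) z = dot y (B' z)) ->
  (forall y, differentiable q y) -> (forall y, 'D_(B y) q y = B (q y)) ->
  exp_closure B A -> q (A x) = A (q x).
Proof.
move=> adj dq Bq [_ hA].
(* [sk k] is a time whose exponential approximates [A] in operator norm to within 1/(k + 1);
   commutation then passes to the limit by continuity of [q]. *)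
pose sk k := projT1 (cid (hA (k.+1%:R^-1) ltac:(by rewrite invr_gt0 ltr0n))).
have skP k y : `|A y - exp_lin (sk k) B y| <= k.+1%:R^-1 * `|y|.
  by rewrite /sk; case: cid.
have cvgA y : exp_lin (sk k) B y @[k --> \oo] --> A y.
  have k0 : (k.+1%:R^-1 : R) * `|y| @[k --> \oo] --> (0 : R).
    by rewrite -(mul0r `|y|); apply: cvgM; [exact: cvg_harmonic|exact: cvg_cst].
  apply: cvg_zero; apply: norm_cvg0; apply: (squeeze_cvgr _ (cvg_cst 0) k0).
  by near=> k; rewrite normr_ge0 /= distrC; exact: skP.
have cq := cvg_comp _ _ (cvgA x) (differentiable_continuous (dq (A x))).
apply: (cvg_unique _ cq) => //=.
have -> : q \o (fun k => exp_lin (sk k) B x) = fun k => exp_lin (sk k) B (q x).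
  by apply/funext => k; exact: exp_lin_commute adj dq Bq.
exact: cvgA.
Unshelve. all: end_near. Qed.

End ExponentialFlow.

(** * The inner product on homogeneous polynomials *)

Lemma is_derive_linear_comp (R : realType) (V V' W : normedModType R) (g : V -> V')
    (q : V' -> W) x u d : linear g ->
  is_derive (g x) (g u) q d -> is_derive x u (q \o g) d.
Proof.
move=> lg /is_derive_cvg hq; apply: cvg_is_derive.
rewrite [X in X @ _ --> _](_ : _ = fun h : R =>
  h^-1 *: (q (h *: g u + g x) - q (g x)))//.
by apply/funext => h /=; rewrite lg.
Qed.

Section Tensors.
Context (R : realType) (V : finNormedModType R) (dot : {dot V for idfun}).
Hypothesis normE : forall x : V, `|x| ^+ 2 = dot x x.
Context (n : nat) (e : 'I_n -> V).
Hypothesis eE : forall x, x = \sum_i dot x (e i) *: e i.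

Lemma dot_basisE x y : dot x y = \sum_i dot x (e i) * dot y (e i).
Proof.
rewrite {1}(eE y) dot_sumr; apply: eq_bigr => i _.
by rewrite dotZr mulrC.
Qed.

(* In the orthonormal basis [e], [tensor l] is the space of l-linear maps V^l -> V,
   with its Euclidean structure [tform]; [teval T x] is T(x, ..., x), [tad B] is
   the derivation lifting p |-> B p - dp(B), [tact g] is the action T |-> g T g^-1
   of an isometry and [tens l q] is the symmetric tensor d^l q / l!. *)
Fixpoint tensor (l : nat) : vectType R :=
  if l is l'.+1 then {ffun 'I_n -> tensor l'} : vectType R else V : vectType R.

Fixpoint teval (l : nat) : tensor l -> V -> V :=
  if l is l'.+1 then fun (T : {ffun 'I_n -> tensor l'}) x =>
    \sum_m dot x (e m) *: teval (T m) x
  else fun T _ => T.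

Fixpoint tform (l : nat) : tensor l -> tensor l -> R :=
  if l is l'.+1 then fun (T U : {ffun 'I_n -> tensor l'}) => \sum_m tform (T m) (U m)
  else fun T U => dot T U.

Fixpoint tad (B : V -> V) (l : nat) : tensor l -> tensor l :=
  if l is l'.+1 then fun (T : {ffun 'I_n -> tensor l'}) =>
    [ffun m => tad B (T m) - \sum_a dot (B (e m)) (e a) *: T a]
  else fun T => B T.

Fixpoint tact (g : V -> V) (l : nat) : tensor l -> tensor l :=
  if l is l'.+1 then fun (T : {ffun 'I_n -> tensor l'}) =>
    [ffun m => \sum_a dot (g (e a)) (e m) *: tact g (T a)]
  else fun T => g T.

Fixpoint tens (l : nat) : (V -> V) -> tensor l :=
  if l is l'.+1 then fun q =>
    [ffun m => (l'.+1%:R)^-1 *: tens l' ('D_(e m) q)] : {ffun 'I_n -> tensor l'}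
  else fun q => q 0.

Lemma teval_linear l x : linear (fun T => teval (l := l) T x).
Proof.
elim: l => [|l IH] a T U //=.
rewrite scaler_sumr -big_split; apply: eq_bigr => m _ /=.
by rewrite !ffunE IH scalerDr !scalerA mulrC.
Qed.

Lemma tact_linear g l : linear g -> linear (tact g (l := l)).
Proof.
move=> lg; elim: l => [|l IH] a T U /=; first exact: lg.
apply/ffunP => m; rewrite !ffunE scaler_sumr -big_split; apply: eq_bigr => i _ /=.
by rewrite !ffunE IH scalerDr !scalerA mulrC.
Qed.

Lemma tad_linear B l : linear B -> linear (tad B (l := l)).
Proof.
move=> lB; elim: l => [|l IH] a T U /=; first exact: lB.
apply/ffunP => m; rewrite !ffunE IH scalerBr -addrA -[RHS]addrA; congr (_ + _).
rewrite [RHS]addrCA; congr (_ + _); rewrite -opprD; congr (- _).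
rewrite scaler_sumr -big_split; apply: eq_bigr => i _ /=.
by rewrite !ffunE scalerDr !scalerA mulrC.
Qed.

Lemma tform_sym l (T U : tensor l) : tform T U = tform U T.
Proof.
elim: l T U => [|l IH] T U /=; first exact: dotC.
by apply: eq_bigr => m _; exact: IH.
Qed.

Lemma tformD l (T U X : tensor l) : tform (T + U) X = tform T X + tform U X.
Proof.
elim: l T U X => [|l IH] T U X /=; first exact: dotDl.
by rewrite -big_split; apply: eq_bigr => m _; rewrite ffunE IH.
Qed.

Lemma tformZ l a (T X : tensor l) : tform (a *: T) X = a * tform T X.
Proof.
elim: l T X => [|l IH] T X /=; first exact: dotZl.
by rewrite mulr_sumr; apply: eq_bigr => m _; rewrite ffunE IH.
Qed.

Lemma tform_ge0 l (T : tensor l) : 0 <= tform T T.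
Proof.
elim: l T => [|l IH] T /=; first by rewrite -normE exprn_ge0.
by apply: sumr_ge0 => m _; exact: IH.
Qed.

Lemma tform_eq0 l (T : tensor l) : tform T T = 0 -> T = 0.
Proof.
elim: l T => [|l IH] T /=.
  by rewrite -normE => /eqP; rewrite expf_eq0/= normr_eq0 => /eqP.
move=> /eqP; rewrite psumr_eq0 => [/allP T0|m _]; last exact: tform_ge0.
apply/ffunP => m; rewrite ffunE; apply: IH; apply/eqP.
by have := T0 m; rewrite mem_index_enum; apply.
Qed.

Lemma tform_suml l k (c : 'I_k -> R) (T : 'I_k -> tensor l) X :
  tform (\sum_i c i *: T i) X = \sum_i c i * tform (T i) X.
Proof.
elim: k c T => [|k IH] c T; last by rewrite !big_ord_recl tformD tformZ IH.
by rewrite !big_ord0 -(scale0r (0 : tensor l)) tformZ mul0r.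
Qed.

(** The two parts of the derivation transpose separately: the part acting on values by induction,
    the part acting on the first index because the matrix of [B'] is the transpose of that of
    [B]. *)
Lemma tad_adjoint (B B' : V -> V) l (T U : tensor l) :
  (forall y z, dot (B y) z = dot y (B' z)) -> tform (tad B T) U = tform T (tad B' U).
Proof.
move=> adj; elim: l T U => [|l IH] T U /=; first exact: adj.
have tformB (X Y Z : tensor l) : tform (X - Y) Z = tform X Z - tform Y Z.
  by rewrite tformD -scaleN1r tformZ mulN1r.
under eq_bigr do rewrite ffunE tformB IH tform_suml.
under [RHS]eq_bigr do rewrite ffunE tform_sym tformB tform_suml tform_sym.
rewrite !sumrB; congr (_ - _); rewrite exchange_big; apply: eq_bigr => a _ /=.
by apply: eq_bigr => m _; rewrite adj dotC [tform (U m) _]tform_sym.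
Qed.

Lemma hpoly_teval l (T : tensor l) : hpoly dot l (teval T).
Proof.
elim: l T => [|l IH] T; first exact: hpoly_cst.
by apply: (hpoly_sum (p := fun m x => dot x (e m) *: teval (T m) x)) => m; exact: hpoly_dot.
Qed.

Lemma hpoly_derive_sum l k (p : 'I_k -> V -> V) x u : (forall i, hpoly dot l (p i)) ->
  'D_u (fun y => \sum_i p i y) x = \sum_i 'D_u (p i) x.
Proof.
move=> hp; elim: k p hp => [|k IH] p hp.
  by under eq_fun do rewrite big_ord0; rewrite big_ord0 derive_cst.
rewrite big_ord_recl -IH//; under eq_fun do rewrite big_ord_recl.
by rewrite (hpoly_deriveD normE _ _ (hp _) (hpoly_sum (fun i => hp (lift ord0 i)))).
Qed.

(** Contracted with [x], the index part of [tad] is what the product rule produces when the linear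
    form [dot x (e m)] is differentiated along [B x]; the other part is the induction hypothesis. *)
Lemma teval_tad (B : V -> V) l (T : tensor l) x : linear B ->
  teval (tad B T) x = B (teval T x) - 'D_(B x) (teval T) x.
Proof.
move=> lB; elim: l T => [|l IH] T /=; first by rewrite derive_cst subr0.
have dE : 'D_(B x) (fun y => \sum_m dot y (e m) *: teval (T m) y) x =
    \sum_m (dot (B x) (e m) *: teval (T m) x + dot x (e m) *: 'D_(B x) (teval (T m)) x).
  rewrite (hpoly_derive_sum (l := l.+1)) => [|i]; last by apply: hpoly_dot; exact: hpoly_teval.
  by apply: eq_bigr => m _; rewrite (hpoly_deriveM normE _ _ _ (hpoly_teval (T m))).
rewrite dE (linear_fun_sum lB) -sumrB.
have BE a : dot (B x) (e a) = \sum_m dot x (e m) * dot (B (e m)) (e a).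
  by rewrite (linear_basisE eE lB) dot_suml; apply: eq_bigr => m _; rewrite dotZl.
have E : \sum_m dot x (e m) *: \sum_a dot (B (e m)) (e a) *: teval (T a) x =
    \sum_a dot (B x) (e a) *: teval (T a) x.
  under [RHS]eq_bigr do rewrite BE scaler_suml.
  rewrite [RHS]exchange_big; apply: eq_bigr => m _ /=.
  by rewrite scaler_sumr; apply: eq_bigr => a _; rewrite scalerA.
transitivity (\sum_m dot x (e m) *: (B (teval (T m) x) - 'D_(B x) (teval (T m)) x -
    \sum_a dot (B (e m)) (e a) *: teval (T a) x)).
  apply: eq_bigr => m _; rewrite ffunE (linear_funB (teval_linear x)) IH.
  by rewrite (linear_fun_sum (teval_linear x)).
transitivity (\sum_m dot x (e m) *: (B (teval (T m) x) - 'D_(B x) (teval (T m)) x) -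
    \sum_a dot (B x) (e a) *: teval (T a) x); last first.
  by rewrite -sumrB; apply: eq_bigr => m _; rewrite scalerBr opprD addrA addrAC.
rewrite -E -sumrB; apply: eq_bigr => m _; by rewrite scalerBr.
Qed.

Section Isometry.
Context (g gi : V -> V) (lg : linear g) (giK : cancel gi g).
Hypothesis g_dot : forall x y, dot (g x) (g y) = dot x y.

Lemma isometry_basisE x : x = \sum_a dot x (g (e a)) *: g (e a).
Proof.
rewrite -{1}(giK x) (linear_basisE eE lg); apply: eq_bigr => a _.
by rewrite -g_dot giK.
Qed.

Lemma teval_tact l (T : tensor l) x : teval (tact g T) (g x) = g (teval T x).
Proof.
elim: l T => [//|l IH] T /=; rewrite (linear_fun_sum lg).
under eq_bigr => m _ do rewrite ffunE (linear_fun_sum (teval_linear _)) scaler_sumr.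
rewrite exchange_big; apply: eq_bigr => a _ /=.
under eq_bigr do rewrite IH scalerA.
by rewrite -scaler_suml -dot_basisE g_dot.
Qed.

(** On indices, summing the matrices of [g] and [B] over the basis makes [g] meet the adjoint of
    [B]; this is where the commutation law of [B'] enters, in addition to that of [B]. *)
Lemma tad_tact (B B' : V -> V) s l (T : tensor l) : linear B ->
  (forall y z, dot (B y) z = dot y (B' z)) ->
  (forall y, B (g y) = s *: g (B y)) -> (forall y, B' (g y) = s *: g (B' y)) ->
  tad B (tact g T) = s *: tact g (tad B T).
Proof.
move=> lB adj Bg B'g; elim: l T => [|l IH] T /=; first exact: Bg.
apply/ffunP => m; rewrite !ffunE.
rewrite (linear_fun_sum (tad_linear (l := l) lB)).
under [X in _ = s *: X]eq_bigr => a _ do rewrite ffunE (linear_funB (tact_linear (l := l) lg))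
  (linear_fun_sum (tact_linear (l := l) lg)) scalerBr.
rewrite sumrB scalerBr; congr (_ - _).
  rewrite scaler_sumr; apply: eq_bigr => a _.
  by rewrite IH !scalerA mulrC.
under eq_bigr => b _ do rewrite ffunE scaler_sumr.
under [in RHS]eq_bigr => a _ do rewrite scaler_sumr.
rewrite exchange_big [in RHS]exchange_big scaler_sumr /=; apply: eq_bigr => a _.
under eq_bigr do rewrite scalerA.
under [in RHS]eq_bigr do rewrite scalerA.
rewrite -!scaler_suml scalerA; congr (_ *: _).
have -> : \sum_i dot (g (e i)) (e m) * dot (B (e i)) (e a) = dot (g (B' (e a))) (e m).
  rewrite (linear_basisE eE lg) dot_suml; apply: eq_bigr => i _.
  by rewrite dotZl mulrC adj dotC.
by rewrite -dotZl -B'g -dot_basisE dotC [LHS]dotC adj dotC.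
Qed.

End Isometry.

(** Contracting the first index gives the sum of x_m times the partial derivatives of q. By Euler's
    identity this is (l + 1) q, which cancels the normalizing factor at each level. *)
Lemma hpoly_tens l q x : hpoly dot l q -> teval (tens l q) x = q x.
Proof.
elim: l q => [|l IH] q hq /=.
  by have := hpolyE 0 x hq; rewrite expr0 scale1r scale0r.
have hD m : hpoly dot l ('D_(e m) q) by have [] := hpoly_derive normE (e m) hq.
under eq_bigr => m _ do
  rewrite ffunE (linear_funZ (teval_linear _)) IH// scalerA mulrC -scalerA.
rewrite -scaler_sumr; have dq := hpoly_differentiable normE x hq.
have -> : \sum_m dot x (e m) *: 'D_(e m) q x = 'D_x q x.
  transitivity ('d q x (\sum_m dot x (e m) *: e m)); last by rewrite -eE deriveE.
  by rewrite linear_sum; apply: eq_bigr => m _; rewrite linearZ deriveE.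
by rewrite (euler normE x hq) scalerA mulVf ?scale1r// pnatr_eq0.
Qed.

Lemma tens_sum l k (c : 'I_k -> R) (q : 'I_k -> V -> V) : (forall i, hpoly dot l (q i)) ->
  tens l (fun x => \sum_i c i *: q i x) = \sum_i c i *: tens l (q i).
Proof.
elim: l k c q => [//|l IH] k c q hq /=; apply/ffunP => m; rewrite ffunE.
have hD i : hpoly dot l ('D_(e m) (q i)) by have [] := hpoly_derive normE (e m) (hq i).
have -> : 'D_(e m) (fun x => \sum_i c i *: q i x) =
    fun x => \sum_i c i *: 'D_(e m) (q i) x.
  apply/funext => x; rewrite (hpoly_derive_sum _ _ (fun i => hpolyZ (c i) (hq i))).
  apply: eq_bigr => i _; have [dq _] := hpoly_is_derive normE x (e m) (hq i).
  by rewrite -deriveZ.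
rewrite IH// sum_ffunE scaler_sumr; apply: eq_bigr => i _.
by rewrite !ffunE !scalerA mulrC.
Qed.

(** Two maps appear because partial derivatives of an equivariant map are not equivariant. The pair
    q, qt conjugate under [g] does pass to derivatives: ['D_(g u) qt] is conjugate to ['D_u q], and
    the vectors [g (e a)] again expand every vector. *)
Lemma tens_tact g gi l q qt : linear g -> cancel gi g ->
  (forall x y, dot (g x) (g y) = dot x y) -> hpoly dot l q -> hpoly dot l qt ->
  (forall x, qt (g x) = g (q x)) -> tens l qt = tact g (tens l q).
Proof.
move=> lg giK g_dot; elim: l q qt => [|l IH] q qt hq hqt qE /=.
  by rewrite -qE (linear_fun0 lg).
apply/ffunP => m; rewrite !ffunE.
have dE : 'D_(e m) qt = fun x => \sum_a dot (g (e a)) (e m) *: 'D_(g (e a)) qt x.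
  apply/funext => x; have dq := hpoly_differentiable normE x hqt.
  rewrite deriveE// {1}(isometry_basisE lg giK g_dot (e m)) linear_sum.
  by apply: eq_bigr => a _; rewrite linearZ deriveE// dotC.
have hD u : hpoly dot l ('D_u qt) by have [] := hpoly_derive normE u hqt.
have hD' u : hpoly dot l ('D_u q) by have [] := hpoly_derive normE u hq.
rewrite dE tens_sum// scaler_sumr; apply: eq_bigr => a _.
rewrite !ffunE (linear_funZ (tact_linear (l := l) lg)).
rewrite (IH ('D_(e a) q)) ?scalerA 1?mulrC// => x.
have dqt := hpoly_is_derive normE (g x) (g (e a)) hqt.
have [_ <-] := is_derive_linear_comp lg dqt.
have -> : qt \o g = g \o q by apply/funext => y; exact: qE.
have dq := hpoly_is_derive normE x (e a) hq.
by have [_ ->] := is_derive_linear lg (fin_linear_continuous normE eE lg) dq.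
Qed.

Lemma tad_form_eq0 (A At : V -> V) l (T : tensor l) :
  (forall y z, dot (A y) z = dot y (At z)) -> tad At (tad A T) = 0 -> tad A T = 0.
Proof.
move=> adj AtA; apply: tform_eq0; rewrite (tad_adjoint _ _ adj) AtA tform_sym.
by rewrite -(scale0r (0 : tensor l)) tformZ mul0r.
Qed.

(** [adjoint_decomposition] is applied to the lifts of ad_L and ad_{L^t} on tensors. The witnesses
    are chosen before [g], so the same p and q' serve all group elements; [s] stands for
    sigma(g). *)
Lemma equivariant_decomposition (L Lt : V -> V) l (q : V -> V) :
  linear L -> linear Lt -> (forall y z, dot (L y) z = dot y (Lt z)) -> hpoly dot l q ->
  exists p q', [/\ hpoly dot l p, hpoly dot l q',
    forall x, q x = L (p x) - 'D_(L x) p x + q' x,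
    forall x, 'D_(Lt x) q' x = Lt (q' x) &
    forall (g gi : V -> V) (s : R), linear g -> cancel gi g ->
      (forall x y, dot (g x) (g y) = dot x y) -> s * s = 1 ->
      (forall x, L (g x) = s *: g (L x)) -> (forall x, Lt (g x) = s *: g (Lt x)) ->
      (forall x, q (g x) = s *: g (q x)) ->
      (forall x, p (g x) = g (p x)) /\ (forall x, q' (g x) = s *: g (q' x))].
Proof.
move=> lL lLt adj hq.
have adj' y z : dot (Lt y) z = dot y (L z) by rewrite dotC -adj dotC.
pose A : {linear tensor l -> tensor l} := HB.pack (tad L (l := l))
  (GRing.isLinear.Build _ _ _ _ _ (tad_linear lL)).
pose At : {linear tensor l -> tensor l} := HB.pack (tad Lt (l := l))
  (GRing.isLinear.Build _ _ _ _ _ (tad_linear lLt)).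
pose T := tens l q.
have [z zP] : exists z, tad Lt (T - tad L (tad Lt z)) = 0.
  have tform_gt0 (X : tensor l) : X != 0 -> 0 < tform X X.
    by rewrite lt_def tform_ge0 andbT; apply: contra => /eqP/tform_eq0->.
  have adjA X Y : tform (linfun A X) Y = tform X (linfun At Y).
    by rewrite !lfunE; exact: tad_adjoint.
  have := @adjoint_decomposition R (tensor l) (@tform l) (@tform_sym l)
    (@tformZ l) tform_gt0 _ _ adjA T.
  move=> [z].
  by rewrite !lfunE; exists z.
set P := tad Lt z in zP; set Q := T - tad L P in zP.
have TE : T = tad L P + Q by rewrite addrC subrK.
exists (teval P), (teval Q); split.
- exact: hpoly_teval.
- exact: hpoly_teval.
- move=> x; rewrite -teval_tad// -(hpoly_tens x hq) -/T TE.
  by have := teval_linear x 1 (tad L P) Q; rewrite !scale1r.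
- move=> x; have := teval_tad Q x lLt; rewrite zP => /esym/eqP.
  rewrite (_ : teval 0 x = 0) ?subr_eq0; first by move=> /eqP.
  by rewrite (linear_fun0 (teval_linear x)).
move=> g gi s lg giK g_dot ss Lg Ltg qg.
have tZ B b (X : tensor l) : linear B -> tad B (b *: X) = b *: tad B X.
  by move=> lB; rewrite (linear_funZ (tad_linear lB)).
have gT : tact g T = s *: T.
  (* Since s s = 1, the law q g = s g q says that s q is the conjugate of q under [g], the form that
     [tens_tact] takes. *)
  have hsq : hpoly dot l (fun x => s *: q x) by exact: hpolyZ.
  rewrite -(tens_tact lg giK g_dot hq hsq) => [|x]; last by rewrite qg scalerA ss scale1r.
  have := tens_sum (fun _ : 'I_1 => s) (fun _ : 'I_1 => hq).
  by under eq_fun do rewrite big_ord1; rewrite big_ord1.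
have LgT (X : tensor l) : tad L (tact g X) = s *: tact g (tad L X).
  exact: tad_tact adj Lg Ltg.
have LtgT (X : tensor l) : tad Lt (tact g X) = s *: tact g (tad Lt X).
  exact: tad_tact adj' Ltg Lg.
have gP : tact g P = P.
  (* The difference D of gP and P lies in the image of ad_{L^t}, and ad_L D = Q - s gQ lies in the
     kernel of ad_{L^t}. Applying [tad_form_eq0] for each of the two adjoint pairs gives ad_L D = 0
     and then D = 0. *)
  apply/eqP; rewrite -subr_eq0; apply/eqP.
  have dE : tact g P - P = tad Lt (s *: tact g z - z).
    by rewrite (linear_funB (tad_linear lLt)) tZ// LtgT scalerA ss scale1r.
  rewrite dE; apply: (tad_form_eq0 adj'); rewrite -dE; apply: (tad_form_eq0 adj).
  have -> : tad L (tact g P - P) = Q - s *: tact g Q.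
    rewrite (linear_funB (tad_linear lL)) LgT /Q (linear_funB (tact_linear lg)) gT.
    rewrite scalerBr scalerA ss scale1r opprB addrA addrAC.
    by rewrite [T - _ - _]addrAC subrr add0r [RHS]addrC.
  rewrite (linear_funB (tad_linear lLt)) tZ// LtgT zP.
  have -> : tact g (0 : tensor l) = 0 by rewrite (linear_fun0 (tact_linear lg)).
  by rewrite !scaler0 subr0.
have gQ : tact g Q = s *: Q.
  rewrite /Q (linear_funB (tact_linear lg)) gT scalerBr; congr (_ - _).
  by rewrite -{2}gP LgT scalerA ss scale1r.
split => x; first by rewrite -[in LHS]gP (teval_tact lg g_dot).
have := teval_tact lg g_dot Q x; rewrite gQ (linear_funZ (teval_linear (g x))) => <-.
by rewrite scalerA ss scale1r.
Qed.

End Tensors.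

(** * Tangent vectors *)

Lemma near_eq_smooth_at (R : realType) (V W : normedModType R) (f g : V -> W) x :
  (\forall y \near x, f y = g y) -> smooth_at f x -> smooth_at g x.
Proof.
move=> fg /smooth_atP[U [oU Ux fU]]; apply/smooth_atP.
exists (U `&` interior [set y | f y = g y]).
have oI : open (U `&` interior [set y | f y = g y]).
  by apply: openI => //; exact: open_interior.
split => //; apply: (@eq_smooth_in _ _ _ oI _ f) => [y [_ /interior_subset]//|].
by apply: smooth_in_subset fU => y [].
Qed.

Section TangentSpace.
Context (R : realType) (V : finNormedModType R) (dot : {dot V for idfun}).
Hypothesis normE : forall x : V, `|x| ^+ 2 = dot x x.
Context (n : nat) (e : 'I_n -> V).
Hypothesis eE : forall x, x = \sum_i dot x (e i) *: e i.

Lemma MjE_smooth_at j (f : V -> V) : MjE j f -> smooth_at f 0.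
Proof.
move=> /(MjE_le (leq0n j)) [m [a [g [_ gs fE]]]].
apply: (@near_eq_smooth_at _ _ _ (fun x => \sum_i g i x)).
  by apply: filterS fE => x ->; apply: eq_bigr => i _; rewrite big_ord0 scale1r.
elim: m {a fE} g gs => [|m IH] g gs.
  by under eq_fun do rewrite big_ord0; exact: smooth_at_cst.
under eq_fun do rewrite big_ord_recl; apply: smooth_at_add => //.
by apply: IH => i.
Qed.

Lemma hpoly_homotopy_smooth l (p : V -> V) :
  hpoly dot l p -> smooth_at (fun z : V * R => z.1 + z.2 *: p z.1) (0, 0).
Proof.
move=> hp; apply/smooth_atP; exists setT; split => //; first exact: openT.
have oT : open [set: V * R] by exact: openT.
have s1 : smooth_in [set: V * R] fst.
  by apply: smooth_in_linear => // z; exact: cvg_fst.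
have s2 : smooth_in [set: V * R] (snd : V * R -> R^o).
  by apply: smooth_in_linear => // z; exact: cvg_snd.
apply: smooth_in_add => //; apply: smooth_in_scale => //.
elim: hp => {l p} [l|w|l p q _ IHp _ IHq|l v p _ IH].
- exact: smooth_in_cst.
- exact: smooth_in_cst.
- exact: smooth_in_add.
- have sv : smooth_in [set: V * R] (fun z => dot z.1 v : R^o).
    apply: (smooth_in_comp_linear oT (dot_linear dot v) _ s1).
    exact: dot_continuous.
  exact: (smooth_in_scale oT sv IH).
Qed.

(* With w t = (1 + tM)^-1 (u t), the increment quotient of w is that of u minus
   M (w t), and w is bounded near 0, hence continuous at 0. *)
Lemma perturbed_identity_derive (M : {linear V -> V}) (A : R -> 'End(V))
    (u : R -> V) (du : V) :
  (forall t v, A t v = v + t *: M v) -> is_derive (0 : R) (1 : R) u du ->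
  is_derive (0 : R) (1 : R) (fun t => (A t)^-1%VF (u t)) (du - M (u 0)).
Proof.
move=> AE hu; have [K K0 MK] := fin_linear_bounded normE eE (linearP M).
pose w t := (A t)^-1%VF (u t).
have small_t : \forall t \near (0 : R), `|t| * K <= 2^-1.
  exists (2^-1 / K) => [|t /=]; first by rewrite /= divr_gt0.
  by rewrite sub0r normrN ltr_pdivlMr// => /ltW.
(* For small t the operator [A t] shrinks norms by at most one half, so it is injective and, in
   finite dimension, invertible; the same bound controls [w]. *)
have lowA t v : `|t| * K <= 2^-1 -> `|v| <= 2 * `|A t v|.
  move=> tK; rewrite AE.
  have h1 : `|v| <= `|v + t *: M v| + `|t *: M v|.
    by rewrite -{1}(addrK (t *: M v) v); exact: ler_normB.
  have h2 : `|t *: M v| <= 2^-1 * `|v|.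
    rewrite normrZ; apply: le_trans (ler_wpM2l (normr_ge0 t) (MK v)) _.
    by rewrite mulrA ler_wpM2r.
  lra.
have AK t v : `|t| * K <= 2^-1 -> A t ((A t)^-1%VF v) = v.
  move=> tK; apply: lker0_lfunVK; apply/lker0P => v1 v2 v12.
  apply/eqP; rewrite -subr_eq0 -normr_le0.
  have E : A t (v1 - v2) = A t v1 - A t v2 := raddfB (A t) v1 v2.
  by apply: le_trans (lowA t _ tK) _; rewrite E v12 subrr normr0 mulr0.
have wE t : `|t| * K <= 2^-1 -> w t + t *: M (w t) = u t.
  by move=> tK; rewrite -AE; exact: AK.
have w0 : w 0 = u 0 by rewrite -(wE 0) ?scale0r ?addr0// normr0 mul0r invr_ge0.
have cu : {for 0, continuous u}.
  by apply: differentiable_continuous; apply/derivable1_diffP; have [] := hu.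
have cu0 : u t @[t --> (0 : R)^'] --> u 0 by exact: cvg_within_filter cu.
have cw : w t @[t --> (0 : R)^'] --> u 0.
  have tMw : t *: M (w t) @[t --> (0 : R)^'] --> (0 : V).
    apply: norm_cvg0.
    have lim0 : `|t| * (K * (2 * `|u t|)) @[t --> (0 : R)^'] --> (0 : R).
      have n0 : `|t| @[t --> (0 : R)^'] --> `|0 : R| by apply: cvg_norm; exact: cvg_dnbhs0_id.
      rewrite normr0 in n0.
      have n1 : K * (2 * `|u t|) @[t --> (0 : R)^'] --> K * (2 * `|u 0|).
        by apply: cvgM; [exact: cvg_cst|apply: cvgM; [exact: cvg_cst|exact: cvg_norm]].
      have n01 : `|t| * (K * (2 * `|u t|)) @[t --> (0 : R)^'] --> 0 * (K * (2 * `|u 0|)).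
        exact: cvgM n0 n1.
      by rewrite mul0r in n01.
    apply: (squeeze_cvgr _ (cvg_cst 0) lim0).
    apply: near_dnbhs0 small_t => t _ tK; rewrite normr_ge0 normrZ ler_wpM2l//.
    apply: le_trans (MK _) _; rewrite ler_wpM2l ?(ltW K0)//.
    by apply: le_trans (lowA t _ tK) _; rewrite /w AK.
  have H : u t - t *: M (w t) @[t --> (0 : R)^'] --> u 0 - 0 by exact: cvgB cu0 tMw.
  rewrite subr0 in H; apply: cvg_trans H; apply: near_eq_cvg.
  by apply: near_dnbhs0 small_t => t _ tK /=; rewrite -(wE t tK) addrK.
apply: cvg_is_derive; rewrite -/(w 0) w0.
have cM : M (w t) @[t --> (0 : R)^'] --> M (u 0).
  have cM0 : {for u 0, continuous M} by exact: (fin_linear_continuous normE eE (linearP M)).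
  exact: (cvg_comp _ _ cw cM0).
have H : t^-1 *: (u (t *: 1 + 0) - u 0) - M (w t) @[t --> (0 : R)^'] --> du - M (u 0).
  by apply: cvgB; [exact: (is_derive_cvg hu)|exact: cM].
apply: cvg_trans H; apply: near_eq_cvg.
apply: near_dnbhs0 small_t => t t0 tK /=.
rewrite -[t *: 1]/(t * 1) mulr1 addr0 -/(w t) -(wE t tK) addrAC scalerDr scalerA mulVf//.
by rewrite scale1r addrK.
Qed.

Context (G : topGroupType) (rho : G -> 'End(V)).

Lemma tangent_space_linear_family k (p h : V -> V) : (0 < k)%N -> hpoly dot k.+1 p ->
  (forall g x, p (rho g x) = rho g (p x)) -> (forall x, differentiable h x) ->
  tangent_space rho h (fun x => 'D_(p x) h x - 'D_(h x) p x).
Proof.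
move=> k0 hp pg dh; exists (fun x t => x + t *: p x); split.
  split; first exact: hpoly_homotopy_smooth hp.
  (* Only the term of degree k + 1 is nonzero; it is an admissible degree because k > 0 makes it at
     least 2. *)
  - near=> t; exists k.+2, (fun l x => if l == k.+1 then t *: p x else 0).
    split => [l l2|x].
      case: eqP => [->|_]; split => [|g x].
      + by apply/(homog_polyP eE); exact: hpolyZ.
      + by rewrite pg linearZ.
      + by apply/(homog_polyP eE); exact: hpoly_zero.
      + by rewrite linear0.
    rewrite big_nat_recr//= eqxx big_nat_cond big1 ?add0r// => l.
    by rewrite andbT => /andP[_ lk]; rewrite ltn_eqF.
  - by move=> x; rewrite scale0r addr0.
near=> x; rewrite derive1E.
have dp := hpoly_differentiable normE x hp.
have dxi t : differentiable (fun y => y + t *: p y) x.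
  by apply: differentiableD => //; apply: differentiableZ.
have AE t v : linfun ('d (fun y => y + t *: p y) x) v = v + t *: 'd p x v.
  rewrite lfunE /= -deriveE// -deriveE//.
  have tp := @is_deriveZ _ _ _ p t x v _ (hpoly_is_derive normE x v hp).
  by have [_ ->] := @is_deriveD _ _ _ id _ x v _ _ (is_derive_id x v) tp.
have hu : is_derive (0 : R) (1 : R) (fun t => h (x + t *: p x)) ('D_(p x) h x).
  apply: is_derive_line; rewrite scale0r addr0.
  by apply/derivableP; exact: diff_derivable.
(* Here M is the differential of p at x and u(t) = h(x + t p(x)), so that M (u 0) is the derivative
   of p along h(x). *)
have [_] := perturbed_identity_derive AE hu.
by rewrite scale0r addr0 -deriveE// => <-.
Unshelve. all: end_near. Qed.

End TangentSpace.

(** * Equivariance of Taylor polynomials *)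

Section JetEquivariance.
Context (R : realType) (V : finNormedModType R) (dot : {dot V for idfun}).
Hypothesis normE : forall x : V, `|x| ^+ 2 = dot x x.
Context (n : nat) (e : 'I_n -> V).
Hypothesis eE : forall x, x = \sum_i dot x (e i) *: e i.

Lemma hpoly0_cst (q : V -> V) x y : hpoly dot 0 q -> q x = q y.
Proof.
move=> hq; have := hpolyE 0 x hq; have := hpolyE 0 y hq.
by rewrite !expr0 !scale1r !scale0r => <-.
Qed.

Lemma hpolyS_at0 l (q : V -> V) : hpoly dot l.+1 q -> q 0 = 0.
Proof. by move=> hq; have := hpolyE 0 0 hq; rewrite exprS mul0r !scale0r. Qed.

Lemma hpoly1_derive (q : V -> V) u x : hpoly dot 1 q -> 'D_u q x = q u.
Proof.
move=> hq; have [hD _] := hpoly_derive normE u hq.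
by rewrite (hpoly0_cst x u hD) (euler normE _ hq) scale1r.
Qed.

Lemma derive_equivariant (g : V -> V) s (q : V -> V) u x : linear g ->
  (forall y, differentiable q y) -> (forall y, q (g y) = s *: g (q y)) ->
  'D_(g u) q (g x) = s *: g ('D_u q x).
Proof.
move=> lg dq qg; have dqg : is_derive (g x) (g u) q ('D_(g u) q (g x)).
  by apply/derivableP; exact: diff_derivable.
have [_ <-] := is_derive_linear_comp lg dqg.
have dq' : is_derive x u q ('D_u q x) by apply/derivableP; exact: diff_derivable.
have lsg : linear (fun y => s *: g y).
  by move=> a y z; rewrite lg scalerDr !scalerA mulrC.
have -> : q \o g = (fun y => s *: g y) \o q by apply/funext => y; exact: qg.
by have [_ ->] := is_derive_linear lsg (fin_linear_continuous normE eE lsg) dq'.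
Qed.

(** The defect q g - s g q is homogeneous of degree l, and near 0 it equals s g r - r g with r = f -
    q the remainder. It is thus small to order l, hence zero everywhere. *)
Lemma homogeneous_part_equivariant (g : V -> V) s l (f q : V -> V) : linear g ->
  hpoly dot l q -> MjE l.+1 (fun x => f x - q x) ->
  (\forall x \near 0, f (g x) = s *: g (f x)) -> forall x, q (g x) = s *: g (q x).
Proof.
move=> lg hq rM fg x; have lsg : linear (fun y => s *: g y).
  by move=> a y z; rewrite lg scalerDr !scalerA mulrC.
apply/eqP; rewrite -subr_eq0; apply/eqP.
have hd : hpoly dot l (fun x => q (g x) + - (s *: g (q x))).
  apply: hpoly_add; first exact: (hpoly_linear_comp eE lg hq).
  exact: (hpolyN (hpoly_comp_linear lsg hq)).
apply: (hpoly_small_eq0 x hd).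
have rs := MjE_small rM.
have lN : linear (fun y => - y : V) by move=> a u v; rewrite opprD scalerN.
apply: (eq_small _ (small_add (small_comp_linear normE eE lN (small_linear_comp lg rs))
  (small_comp_linear normE eE lsg rs))).
apply: filterS fg => y fy; rewrite fy opprB (linear_funB lg) scalerBr.
by rewrite addrA subrK.
Qed.

(** The defect is treated as for a single homogeneous part, but it is a sum of several degrees;
    being small to every order below k, it vanishes by [poly_small_eq0]. *)
Lemma polynomial_part_equivariant (g : V -> V) s k (f : V -> V) (q : nat -> V -> V) :
  linear g -> (forall l, hpoly dot l (q l)) ->
  MjE k (fun x => f x - \sum_(0 <= l < k) q l x) ->
  (\forall x \near 0, f (g x) = s *: g (f x)) ->
  forall x, \sum_(0 <= l < k) q l (g x) = s *: g (\sum_(0 <= l < k) q l x).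
Proof.
move=> lg hq rM fg x; have lsg : linear (fun y => s *: g y).
  by move=> a y z; rewrite lg scalerDr !scalerA mulrC.
have gsum (y : V) : s *: g (\sum_(0 <= l < k) q l y) = \sum_(0 <= l < k) s *: g (q l y).
  elim: (k) => [|m IH]; last first.
    by rewrite !big_nat_recr//= -IH (linear_funD lsg).
  by rewrite !big_geq// (linear_fun0 lsg).
apply/eqP; rewrite -subr_eq0 gsum -sumrB; apply/eqP.
have hd l : hpoly dot l (fun x => q l (g x) + - (s *: g (q l x))).
  apply: hpoly_add; first exact: (hpoly_linear_comp eE lg (hq l)).
  exact: (hpolyN (hpoly_comp_linear lsg (hq l))).
apply: (poly_small_eq0 normE eE (p := fun l x => q l (g x) + - (s *: g (q l x))) x hd) => j jk.
have rs := MjE_small (MjE_le jk rM).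
have lN : linear (fun y => - y : V) by move=> a u v; rewrite opprD scalerN.
apply: (eq_small _ (small_add (small_comp_linear normE eE lN (small_linear_comp lg rs))
  (small_comp_linear normE eE lsg rs))).
apply: filterS fg => y fy; rewrite fy opprB (linear_funB lg) scalerBr.
by rewrite addrA subrK gsum sumrB.
Qed.

Lemma MjE_big_nat j a b (f : nat -> V -> V) : (forall l, (a <= l)%N -> MjE j (f l)) ->
  MjE j (fun x => \sum_(a <= l < b) f l x).
Proof.
move=> fM; have [ba|/ltnW] := leqP b a.
  by apply: eq_MjE (MjE_zero V j); near=> x; rewrite big_geq.
move=> /subnKC <-; elim: (b - a)%N => [|d IH].
  by apply: eq_MjE (MjE_zero V j); near=> x; rewrite addn0 big_geq.
apply: eq_MjE (MjE_add IH (fM (a + d)%N (leq_addr _ _))).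
by near=> x; rewrite addnS big_nat_recr//= leq_addr.
Unshelve. all: end_near. Qed.

Lemma MjE_at0 j (f : V -> V) : MjE j.+1 f -> f 0 = 0.
Proof.
move=> [m [a [g [aM _ /nbhs_singleton ->]]]]; rewrite big1// => i _.
by have [_ a0] := aM i ord0; rewrite big_ord_recl a0 mul0r scale0r.
Qed.

Section TangentVector.
Context (k : nat) (hl : nat -> V -> V) (h : V -> V) (p : V -> V).
Hypotheses (k_gt0 : (0 < k)%N) (h_hom : forall l, hpoly dot l (hl l))
  (hE : forall x, h x = \sum_(0 <= l < k.+1) hl l x) (h0 : h 0 = 0).

Lemma poly_split (F : nat -> V) : F 0%N = 0 ->
  \sum_(0 <= l < k.+1) F l = F 1%N + \sum_(2 <= l < k.+1) F l.
Proof. by move=> F0; rewrite big_ltn// F0 add0r big_ltn// ltnS. Qed.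

Lemma poly_cst0 x : hl 0 x = 0.
Proof.
transitivity (hl 0 0); first exact: hpoly0_cst (h_hom 0).
rewrite -[RHS]h0 hE big_ltn// big_nat_cond big1 ?addr0// => l.
by rewrite andbT; case: l => [//|l] _; exact: hpolyS_at0 (h_hom l.+1).
Qed.

Lemma poly_differentiable x : differentiable h x.
Proof.
rewrite (funext hE); elim: k.+1 => [|m IH].
  by under eq_fun do rewrite big_geq//; exact: differentiable_cst.
under eq_fun do rewrite big_nat_recr//=.
by apply: differentiableD => //; exact: hpoly_differentiable (h_hom m).
Qed.

Lemma poly_derive u x : 'D_u h x = hl 1 u + \sum_(2 <= l < k.+1) 'D_u (hl l) x.
Proof.
have dE m : is_derive x u (fun y => \sum_(0 <= l < m) hl l y)
    (\sum_(0 <= l < m) 'D_u (hl l) x).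
  elim: m => [|m IH].
    by under eq_fun do rewrite big_geq//; rewrite big_geq//; exact: is_derive_cst.
  under eq_fun do rewrite big_nat_recr//=; rewrite big_nat_recr//=.
  by apply: is_deriveD; exact: hpoly_is_derive (h_hom m).
have [_] := dE k.+1; rewrite -(funext hE) => ->.
have [_ /(_ erefl x) D0] := hpoly_derive normE u (h_hom 0).
by rewrite (poly_split (F := fun l => 'D_u (hl l) x) D0) hpoly1_derive.
Qed.

Lemma poly_diff0 u : 'd h 0 u = hl 1 u.
Proof.
rewrite -deriveE; last exact: poly_differentiable.
rewrite poly_derive big_nat_cond big1 ?addr0// => -[|[|l]]//= _.
by have [hD _] := hpoly_derive normE u (h_hom l.+2); exact: hpolyS_at0 hD.
Qed.

(** The linear part of h produces exactly ad_L p and cancels. A part of degree l >= 2 produces terms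
    of degree k + l, which is at least k + 2. *)
Lemma tangent_vector_remainder : hpoly dot k.+1 p ->
  MjE k.+2 (fun x => ('d h 0 (p x) - 'D_('d h 0 x) p x) -
                     ('D_(p x) h x - 'D_(h x) p x)).
Proof.
move=> hp; have dp x := hpoly_differentiable normE x hp.
have DhE x : 'D_(h x) p x = 'D_(hl 1 x) p x + \sum_(2 <= l < k.+1) 'D_(hl l x) p x.
  rewrite deriveE// hE linear_sum (poly_split (F := fun l => 'd p x (hl l x))).
    by rewrite -deriveE//; congr (_ + _); apply: eq_bigr => l _; rewrite deriveE.
  by rewrite poly_cst0 linear0.
apply: (@eq_MjE _ _ _ (fun x => \sum_(2 <= l < k.+1)
    ('D_(hl l x) p x - 'D_(p x) (hl l) x))).
  near=> x; rewrite poly_derive DhE !poly_diff0 sumrB.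
  set X := 'D_(hl 1 x) p x; set Y := \sum_(2 <= l < k.+1) 'D_(p x) (hl l) x.
  set Z := \sum_(2 <= l < k.+1) _; set L := hl 1 (p x).
  by rewrite opprB addrA addrA subrK opprD addrACA subrr add0r.
apply: MjE_big_nat => l l2; apply: MjE_add.
  apply: (@MjE_le _ _ _ (k.+1 + l.-1)).
    by rewrite addSn ltnS -addn1 leq_add2l; case: l l2 => [|[]].
  apply: (hpoly_MjE normE); apply: (hpoly_derive_field normE) => //.
  by case: l l2 => [//|l] _; exact: h_hom.
apply: (@MjE_le _ _ _ (l + k)); first by rewrite -(addn2 k) addnC leq_add2r.
apply: (hpoly_MjE normE); apply: hpolyN.
exact: (hpoly_derive_field normE (h_hom l) hp).
Unshelve. all: end_near. Qed.

End TangentVector.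
End JetEquivariance.

Unset Implicit Arguments.

Theorem theorem3p6 (R : realType) (V : finNormedModType R)
    (dot : {dot V for idfun}) (normE : forall x : V, `|x| ^+ 2 = dot x x)
    (G : topGroupType) (G_lie : lie_group R G) (G_compact : compact [set: G])
    (rho : G -> 'End(V)) (rho_action : linear_action rho)
    (dot_invariant : forall g x y, dot (rho g x) (rho g y) = dot x y)
    (sigma : G -> R) (sigma_hom : sign_hom sigma)
    (k : nat) (k_ge1 : (1 <= k)%N)
    (h : V -> V) (h_jet : rev_equivariant_jet rho sigma k h)
    (Lt : {linear V -> V}) (LtE : adjoint dot ('d h 0) Lt) :
  rev_equivariant_order rho sigma k.+1 `<=`
    germ_add
      (germ_add
        (rev_equivariant_poly_semidirect rho sigma (exp_closure Lt) k.+1)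
        (tangent_space rho h))
      (rev_equivariant_order rho sigma k.+2).
Proof.
have [e [_ eE]] := orthonormal_basis (dotC dot) (dotDl dot) (dotZl dot) (dot_gt0 normE).
have [[hl [hl_homog hE]] [g0 [[_ g0_eq] g00 g0M]]] := h_jet.
have h_hom l : hpoly dot l (hl l) by apply/(homog_polyP eE).
have [rho1 rhoM _] := rho_action; have [sigma1 _] := sigma_hom.
have rhoK g : cancel (rho g^-1%g) (rho g).
  by move=> x; rewrite -comp_lfunE -rhoM mulgV rho1 id_lfunE.
have lrho g : linear (rho g) := linearP (rho g).
have ss g : sigma g * sigma g = 1 by case: (sigma1 g) => ->; rewrite ?mulrNN mulr1.
(* The symmetry is assumed of the germ [g0] near 0; its Taylor polynomial h inherits it at every
   point. *)
have h_eq g x : h (rho g x) = sigma g *: rho g (h x).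
  have rM : MjE k.+1 (fun y => g0 y - \sum_(0 <= l < k.+1) hl l y).
    by apply: eq_MjE g0M; near=> y; rewrite hE.
  rewrite !hE.
  exact: (polynomial_part_equivariant normE eE (lrho g) h_hom rM (g0_eq g)).
have h0 : h 0 = 0.
  by have := MjE_at0 g0M; rewrite g00 sub0r => /eqP; rewrite oppr_eq0 => /eqP.
have dh := poly_differentiable normE h_hom hE.
have L_eq g x : 'd h 0 (rho g x) = sigma g *: rho g ('d h 0 x).
  by rewrite -!deriveE// -(derive_equivariant normE eE x 0 (lrho g) dh (h_eq g)) linear0.
have Lt_eq g x : Lt (rho g x) = sigma g *: rho g (Lt x).
  (* Writing y as the image of its preimage under [rho g] lets the symmetry of L and the invariance
     of the inner product transfer the law to the adjoint. *)
  have E y : dot y (Lt (rho g x)) = dot y (sigma g *: rho g (Lt x)).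
    rewrite -LtE -(rhoK g y) L_eq dotZl dot_invariant LtE dotZr.
    by rewrite dot_invariant.
  by rewrite (eE (Lt _)) [RHS]eE; apply: eq_bigr => i _; rewrite dotC E dotC.
move=> f [fM [f_smooth f_eq]].
have [q [hq qM]] := MjE_leading normE eE fM.
have q_eq g := homogeneous_part_equivariant normE eE (lrho g) hq qM (f_eq g).
have [p [q' [hp hq' qE Lq' eqs]]] :=
  equivariant_decomposition normE eE (linearP ('d h 0)) (linearP Lt) LtE hq.
have {eqs}eqs g := eqs _ _ _ (lrho g) (rhoK g) (dot_invariant g) (ss g)
  (L_eq g) (Lt_eq g) (q_eq g).
have p_eq g := (eqs g).1; have q'_eq g := (eqs g).2.
have dp x := hpoly_differentiable normE x hp.
pose T x := 'D_(p x) h x - 'D_(h x) p x.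
have T_eq g x : T (rho g x) = sigma g *: rho g (T x).
  have p_eq1 y : p (rho g y) = 1 *: rho g (p y) by rewrite scale1r.
  rewrite /T p_eq (derive_equivariant normE eE _ _ (lrho g) dh (h_eq g)) h_eq.
  have -> : 'D_(sigma g *: rho g (h x)) p (rho g x) =
      sigma g *: 'D_(rho g (h x)) p (rho g x).
    by rewrite !deriveE// linearZ.
  rewrite (derive_equivariant normE eE _ _ (lrho g) dp p_eq1) scale1r.
  by rewrite -scalerBr (linear_funB (lrho g)).
(* This is (f - q) + (ad_L p - T): the Taylor remainder plus the error in replacing ad_L p by a true
   tangent vector. *)
have bM : MjE k.+2 (fun x => f x - (q' x + T x)).
  apply: eq_MjE (MjE_add qM (tangent_vector_remainder normE k_ge1 h_hom hE h0 hp)).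
  near=> x; rewrite qE -/(T x).
  set a := 'd h 0 (p x) - _; rewrite -addrA; congr (_ + _).
  by rewrite [a + q' x]addrC [- (q' x + a)]opprD addrA subrK [RHS]opprD.
(* The last summand is defined by subtraction, so its reversible equivariance follows from that of
   f, q' and T. *)
exists (fun x => q' x + T x), (fun x => f x - (q' x + T x)); split.
- exists q', T; split; last by near=> x.
    split; first by apply/(homog_polyP eE).
    move=> A g x SA.
    have adj y z : dot (Lt y) z = dot y ('d h 0 z) by rewrite dotC -LtE dotC.
    have dq' y := hpoly_differentiable normE y hq'.
    by rewrite (exp_closure_commute normE eE (rho g x) adj dq' Lq' SA) q'_eq linearZ.
  exact: (tangent_space_linear_family normE eE k_ge1 hp p_eq dh).
- split; first exact: bM.
  split; first exact: MjE_smooth_at bM.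
  move=> g; apply: filterS (f_eq g) => x fx.
  rewrite fx q'_eq T_eq -scalerDr -scalerBr; congr (_ *: _).
  rewrite (linear_funB (lrho g) (f x) (q' x + T x)); congr (_ - _).
  by rewrite (linear_funD (lrho g) (q' x) (T x)).
- by near=> x; rewrite addrC subrK.
Unshelve. all: end_near. Qed.
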